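(* Let $k \ge 5$ and $n \ge 2$ be integers. Then $$sat(K_k^n, C_4) = \left\lfloor \frac{3(k-1)n-2}{2} \right\rfloor .$$ Moreover, $Sat(K_k^n, C_4) = \mathcal{Y}_k^n$, where equality of the two graph families is understood up to isomorphism (every graph in $Sat(K_k^n,C_4)$ is isomorphic to a graph in $\mathcal{Y}_k^n$ and vice versa).
   Context: All graphs are finite, simple and undirected. $K_k^n$ is the complete $k$-partite graph with $n$ vertices in each part. $N(u)$ is the neighbourhood of $u$, $d(u)=|N(u)|$, $e(H)$ is the number of edges of $H$, $G[A]$ is the subgraph of $G$ induced by $A$, and $[m]=\{1,\dots,m\}$. Saying that $G[A]$ is a perfect matching means that $G[A]$ is a 1-regular graph (every vertex of $A$ has exactly one neighbour in $A$). Given graphs $G$ and $F$, a (spanning) subgraph $H$ of $G$ is $F$-saturated relative to $G$ if $H$ contains no copy of $F$ as a subgraph, but adding any edge of $E(G)\setminus E(H)$ to $H$ creates a copy of $F$. Put $sat(G,F)=\min\{e(H): H \text{ is } F\text{-saturated relative to } G\}$ and $Sat(G,F)=\{H : H \text{ is } F\text{-saturated relative to } G,\ e(H)=sat(G,F)\}$. $C_4$ is the cycle on 4 vertices. Definition of $\mathcal{Y}_k^n$ ($k\ge 5$, $n\ge 2$). It is the family of $k$-partite graphs $G$ with parts $V_1,\dots,V_k$ (independent sets), each of size $n$, with the following properties. (1) If $(k-1)n$ is odd: (i) there is $X^*=\{y_1,y_2,y_3\}\subseteq V_4\cup\dots\cup V_k$ with $G[X^*]=K_3$; (ii) for every $i\in[3]$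 and every $x_i\in V_i$, $N(x_i)=\{y_i\}$; (iii) with $V^*:=\left(\bigcup_{i=4}^k V_i\right)\setminus X^*$, every $u\in V^*$ satisfies $d(u)=2$, $|N(u)\cap X^*|=1$ and $|N(u)\cap V^*|=1$; moreover $G[V^*]$ is a perfect matching such that for every edge $uv$ of $G[V^*]$ we have $\emptyset\ne N(u)\cap N(v)\subseteq X^*$. (2) If $(k-1)n$ is even: partition $V_3$ into $V_3^-$ and $V_3^+$ with $|V_3^-|=n-1$ and $|V_3^+|=1$, and write $V_i^-:=V_i$ for $i\in[2]$ and $V_i^+:=V_i$ for $4\le i\le k$. For some such partition: (i) there is $X^*=\{y_1,y_2,y_3\}\subseteq V_3^+\cup V_4^+\cup\dots\cup V_k^+$ with $G[X^*]=K_3$; (ii) for every $i\in[3]$ and every $x_i\in V_i^-$, $N(x_i)=\{y_i\}$; (iii) with $V^*:=\left(\bigcup_{i=3}^k V_i^+\right)\setminus X^*$, every $u\in V^*$ satisfies $d(u)=2$, $|N(u)\cap X^*|=1$ and $|N(u)\cap V^*|=1$; moreover $G[V^*]$ is a perfect matching such that for every edge $uv$ of $G[V^*]$ we have $\emptyset\ne N(u)\cap N(v)\subseteq X^*$. *)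

(* Defs.v *)
From HB Require Import structures.
From mathcomp Require Import all_boot.

Set Implicit Arguments.
Unset Strict Implicit.
Unset Printing Implicit Defensive.

Section Graphs.
Variable T : finType.

(* A simple graph with vertex set T is its set of edges, each edge being an
   unordered pair of distinct vertices. *)
Record sgraph : Type := SGraph {
  edges :> {set {set T}};
  edgesP : edges \subset [set e : {set T} | #|e| == 2] }.

HB.instance Definition _ := [isSub for edges].
HB.instance Definition _ := [Finite of sgraph by <:].

(* Members of E that are not pairs (e.g. the "loop" [set u; u]) are dropped. *)
Definition graph_of (E : {set {set T}}) : sgraph :=
  SGraph (subsetIr E [set e : {set T} | #|e| == 2]).

Definition adj (G : sgraph) (u v : T) : bool := [set u; v] \in edges G.
Definition nbhd (G : sgraph) (u : T) : {set T} := [set v | adj G u v].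
Definition deg (G : sgraph) (u : T) : nat := #|nbhd G u|.
Definition nedges (G : sgraph) : nat := #|edges G|.

Definition subgraph (H G : sgraph) : bool := edges H \subset edges G.
Definition add_edge (G : sgraph) (e : {set T}) : sgraph :=
  graph_of (e |: edges G).

Definition independent (G : sgraph) (A : {set T}) : Prop :=
  forall u v, u \in A -> v \in A -> ~~ adj G u v.

(* G[A] is a complete graph on m vertices *)
Definition induces_complete (G : sgraph) (A : {set T}) (m : nat) : Prop :=
  #|A| = m /\ (forall u v, u \in A -> v \in A -> u != v -> adj G u v).

(* G[A] is 1-regular *)
Definition induces_perfect_matching (G : sgraph) (A : {set T}) : Prop :=
  forall u, u \in A -> #|nbhd G u :&: A| = 1.

End Graphs.

Definition isomorphic (T U : finType) (G : sgraph T) (H : sgraph U) : Prop :=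
  exists f : T -> U,
    bijective f /\ (forall u v, adj H (f u) (f v) = adj G u v).

(* H contains a (not necessarily induced) copy of F *)
Definition contains (T U : finType) (H : sgraph T) (F : sgraph U) : bool :=
  [exists f : {ffun U -> T},
    injectiveb f && [forall u, forall v, adj F u v ==> adj H (f u) (f v)]].

Definition saturated (T U : finType) (G : sgraph T) (F : sgraph U)
    (H : sgraph T) : bool :=
  [&& subgraph H G, ~~ contains H F
    & [forall e in edges G :\: edges H, contains (add_edge H e) F]].

(* Every saturated H is a subgraph of G, so the default value nedges G does not
   affect the minimum unless no saturated graph exists; see sat_num_attained. *)
Definition sat_num (T U : finType) (G : sgraph T) (F : sgraph U) : nat :=
  \big[minn/nedges G]_(H : sgraph T | saturated G F H) nedges H.

Definition Sat (T U : finType) (G : sgraph T) (F : sgraph U) :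
    {set sgraph T} :=
  [set H | saturated G F H & nedges H == sat_num G F].

Lemma sat_num_le (T U : finType) (G : sgraph T) (F : sgraph U) (H : sgraph T) :
  saturated G F H -> sat_num G F <= nedges H.
Proof.
move=> sH; rewrite /sat_num; have: H \in index_enum _ by exact: mem_index_enum.
elim: (index_enum _) => [//|K r IHr]; rewrite inE big_cons.
case/predU1P => [<-|/IHr le_r]; first by rewrite sH geq_minl.
by case: ifP => _ //; rewrite geq_min le_r orbT.
Qed.

Lemma sat_num_attained (T U : finType) (G : sgraph T) (F : sgraph U)
    (H0 : sgraph T) :
  saturated G F H0 -> exists H, H \in Sat G F.
Proof.
move=> sH0; case: (arg_minnP (@nedges T) sH0) => H sH minH.
exists H; rewrite inE sH eqn_leq sat_num_le // andbT /sat_num.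
apply: (big_ind (leq (nedges H))) => [|a b Ha Hb|K /minH //].
  by apply: subset_leq_card; case/and3P: sH.
by rewrite leq_min Ha Hb.
Qed.

(* the cycle on m vertices, for m >= 3 *)
Definition cycle_graph (m : nat) : sgraph 'I_m :=
  graph_of [set [set i; ordS i] | i : 'I_m].

(* K_k^n: the i-th part consists of the pairs (i, _) *)
Definition complete_multipartite (k n : nat) : sgraph ('I_k * 'I_n)%type :=
  graph_of [set [set p.1; p.2] |
    p : ('I_k * 'I_n) * ('I_k * 'I_n) & p.1.1 != p.2.1].

(* Families of vertex sets are indexed by nat, only the indices 1, ..., k being
   meaningful. *)
Definition multipartition (k n : nat) (T : finType) (G : sgraph T)
    (V : nat -> {set T}) : Prop :=
  [/\ \bigcup_(1 <= i < k.+1) V i = [set: T],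
      forall i j, 1 <= i <= k -> 1 <= j <= k -> i != j -> [disjoint V i & V j],
      forall i, 1 <= i <= k -> #|V i| = n
    & forall i, 1 <= i <= k -> independent G (V i)].

(* Conditions (i)-(iii), common to both parities: W 1, W 2, W 3 are the sets of
   pendant vertices attached to y 1, y 2, y 3, and P is the set of all the other
   vertices, so that X is X^* and P :\: X is V^*. *)
Definition Y_structure (T : finType) (G : sgraph T)
    (W : nat -> {set T}) (P : {set T}) : Prop :=
  exists y : nat -> T,
  let X := [set y 1; y 2; y 3] in
  let Vstar := P :\: X in
  [/\ X \subset P /\ induces_complete G X 3,
      forall i x, 1 <= i <= 3 -> x \in W i -> nbhd G x = [set y i],
      forall u, u \in Vstar ->
        [/\ deg G u = 2, #|nbhd G u :&: X| = 1 & #|nbhd G u :&: Vstar| = 1],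
      induces_perfect_matching G Vstar
    & forall u v, u \in Vstar -> v \in Vstar -> adj G u v ->
        nbhd G u :&: nbhd G v != set0 /\ nbhd G u :&: nbhd G v \subset X].

Definition Y_family (k n : nat) (T : finType) (G : sgraph T) : Prop :=
  exists2 V : nat -> {set T}, multipartition k n G V &
    if odd ((k - 1) * n) then
      Y_structure G V (\bigcup_(4 <= i < k.+1) V i)
    else
      exists V3m V3p : {set T},
        [/\ V3m :|: V3p = V 3, [disjoint V3m & V3p], #|V3m| = n - 1, #|V3p| = 1
          & Y_structure G (fun i => if i == 3 then V3m else V i)
              (V3p :|: \bigcup_(4 <= i < k.+1) V i)].

(* Main.v *)
(** A graph is C4-saturated in K_k^n iff it is properly coloured by the parts,
    C4-free, and any two non-adjacent vertices in different parts are joined by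
    a walk of length 3.  Hence the neighbours of two leaves (vertices of degree
    1) in different parts are distinct and adjacent.  Let N = kn.

    If no three leaves lie in three different parts, then 2e >= 3N - 2n - 3.
    Either some vertex x has an independent neighbourhood such that
    deg x plus the number of leaves not within distance 2 of x is at most n + 1:
    in a breadth-first tree rooted at x all but 2n + 1 vertices are on a non-tree
    edge.  Or all degrees are at least 2 and each vertex of degree 2 lies in a
    triangle x a b; then the degrees of a, b and of the vertices at distance 2
    from x compensate for the vertices of degree 2.

    Otherwise three leaves in different parts have neighbours forming a triangle X.
    A vertex outside X has at most one neighbour in X.  Let A be the vertices
    adjacent to X, B the others, and U the vertices of A with no neighbour
    sharing their neighbour in X.  If v in U is adjacent to y in X, then v lies
    in the same part as the leaves at y; and if v in B lies outside that part,
    then v and y have a common neighbour in A.  Summing degrees gives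
    2e >= 3N - 3n - 3 + 2|B|, and if 2e <= 3N - 3n - 2 then B is empty, U consists
    of at least 3n - 1 leaves, and A \ U is perfectly matched, the ends of a
    matching edge being adjacent to the same vertex of X. *)

Require Import Defs.
From mathcomp Require Import all_boot perm zify.

Set Implicit Arguments.
Unset Strict Implicit.
Unset Printing Implicit Defensive.

(** * Degrees and edge counts *)

Section Basics.
Variables (T : finType) (G : sgraph T).
Implicit Types (u v w : T) (A B : {set T}).

Lemma adjC u v : adj G u v = adj G v u.
Proof. by rewrite /adj setUC. Qed.

Lemma adj_neq u v : adj G u v -> u != v.
Proof. by move/(subsetP (edgesP G)); rewrite inE cards2; case: (u != v). Qed.

Lemma adjxx u : adj G u u = false.
Proof. by apply/negP => /adj_neq; rewrite eqxx. Qed.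

Lemma in_nbhd u v : (v \in nbhd G u) = adj G u v.
Proof. by rewrite inE. Qed.

Lemma degE u : deg G u = #|[set e in edges G | u \in e]|.
Proof.
rewrite /deg -(card_in_imset (f := fun v => [set u; v]) (D := nbhd G u)).
  congr #|pred_of_set _|; apply/setP => e; rewrite inE.
  apply/imsetP/andP => [[v]|[eG ue]].
    by rewrite in_nbhd => uv ->; rewrite set21.
  have := subsetP (edgesP G) _ eG; rewrite inE => /cards2P[x [y [_ De]]].
  have [Dx|Dy] : u = x \/ u = y by move: ue; rewrite De !inE => /orP[]/eqP; auto.
    by exists y; rewrite ?in_nbhd /adj Dx -?De.
  by exists x; rewrite ?in_nbhd /adj Dy setUC -?De.
move=> v w; rewrite !in_nbhd => /adj_neq uv _ Evw.
have : v \in [set u; w] by rewrite -Evw set22.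
by rewrite !inE eq_sym (negPf uv) => /eqP.
Qed.

Lemma sum_deg : \sum_v deg G v = 2 * nedges G.
Proof.
under eq_bigr => v _ do rewrite degE -sum1dep_card.
rewrite (exchange_big_dep (mem (edges G))) => [|v e _ /andP[] //] /=.
rewrite (eq_bigr (fun=> 2)) => [|e eG]; first by rewrite sum_nat_const mulnC.
rewrite sum1dep_card; have := subsetP (edgesP G) _ eG; rewrite inE => /eqP <-.
by apply: eq_card => v; rewrite inE [e \in _]eG.
Qed.

(** Ordered pairs are counted, so an edge with both ends in the intersection of [A] and [B] counts
    twice. *)
Definition edge_count A B : nat := \sum_(v in A) #|nbhd G v :&: B|.

Lemma sum_setC (F : T -> nat) A : \sum_v F v = \sum_(v in A) F v + \sum_(v in ~: A) F v.
Proof.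
by rewrite (bigID (mem A)); congr (_ + _); apply: eq_bigl => v; rewrite ?inE.
Qed.

Lemma sum_setU (F : T -> nat) A B : [disjoint A & B] ->
  \sum_(v in A :|: B) F v = \sum_(v in A) F v + \sum_(v in B) F v.
Proof.
by move=> dAB; rewrite -bigU //; apply: eq_bigl => v; rewrite !inE.
Qed.

Lemma edge_countE A B : edge_count A B = \sum_(v in A) \sum_(w in B) adj G v w.
Proof.
apply: eq_bigr => v _; rewrite -sum1_card big_mkcond [RHS]big_mkcond.
by apply: eq_bigr => w _; rewrite !inE; case: adj; case: (w \in B).
Qed.

Lemma edge_countC A B : edge_count A B = edge_count B A.
Proof.
rewrite !edge_countE exchange_big; apply: eq_bigr => v _.
by apply: eq_bigr => w _; rewrite adjC.
Qed.

Lemma edge_count_setU A B1 B2 : [disjoint B1 & B2] ->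
  edge_count A (B1 :|: B2) = edge_count A B1 + edge_count A B2.
Proof.
move=> dB; rewrite -big_split; apply: eq_bigr => v _ /=.
by rewrite setIUr cardsU -setIIr (disjoint_setI0 dB) setI0 cards0 subn0.
Qed.

Lemma edge_count_setT A : edge_count A [set: T] = \sum_(v in A) deg G v.
Proof. by apply: eq_bigr => v _; rewrite setIT. Qed.

(* Each non-root vertex counts the edge to its parent once from either end, and
   a vertex outside B counts a further, non-tree, edge. *)
Lemma tree_bound (f : T -> T) (l : T -> nat) (r : T) B :
    f r = r -> (forall v, v != r -> adj G v (f v) /\ l (f v) < l v) ->
    (forall v, v \notin B -> exists w, [/\ adj G v w, w != f v & f w != v]) ->
  3 * #|T| <= 2 * nedges G + 2 + #|B|.
Proof.
move=> fr fP BP.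
have degP v : #|[set w | (w != r) && (f w == v)]| + (v != r) + (v \notin B)
    <= deg G v.
  set K := [set w | _].
  have Ksub : K \subset nbhd G v.
    by apply/subsetP => w; rewrite !inE => /andP[/fP[+ _] /eqP <-]; rewrite adjC.
  (* The parent of [v] is not also a child of [v], since [l] strictly decreases towards the root. *)
  have fvK : v != r -> f v \notin K.
    move=> vr; rewrite inE negb_and negbK orbC -implybE.
    by apply/implyP => /eqP ffv; apply/contraT => /fP[_]; rewrite ffv;
      have [_] := fP _ vr; lia.
  pose K1 := if v != r then f v |: K else K.
  have K1sub : K1 \subset nbhd G v.
    rewrite /K1; case: ifP => // /fP[vfv _].
    by rewrite subUset Ksub andbT sub1set inE.
  have cK1 : #|K1| = #|K| + (v != r).
    rewrite /K1; case: ifP => [vr|]; last by rewrite addn0.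
    by rewrite cardsU1 fvK // addnC.
  rewrite -cK1; case: (boolP (v \in B)) => [_|/BP[w [vw wf fw]]].
    by rewrite addn0; apply: subset_leq_card.
  have wK1 : w \notin K1.
    by rewrite /K1; case: ifP; rewrite !inE (negPf fw) ?(negPf wf) ?andbF.
  rewrite addnC -[true + _]/(1 + _); have := cardsU1 w K1; rewrite wK1 => <-.
  by apply: subset_leq_card; rewrite subUset K1sub sub1set inE vw.
have := leq_sum (index_enum T) (fun v (_ : predT v) => degP v).
rewrite sum_deg !big_split /=.
have -> : \sum_v #|[set w | (w != r) && (f w == v)]| = #|T| - 1.
  rewrite subn1 -(cardC1 r) -sum1_card [RHS](partition_big f predT) //=.
  apply: eq_big => // v _; rewrite sum1dep_card.
  by apply: eq_card => w; rewrite !inE.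
have -> : \sum_v (v != r : nat) = #|T| - 1.
  rewrite -big_mkcond sum1dep_card subn1 -(cardC1 r).
  by apply: eq_card => w; rewrite !inE.
have -> : \sum_v (v \notin B : nat) = #|T| - #|B|.
  rewrite -big_mkcond sum1dep_card -(cardsC B) addKn.
  by apply: eq_card => w; rewrite !inE.
have : 0 < #|T| by apply/card_gt0P; exists r.
have := max_card B; move: (nedges G) #|B| #|T| => e b N; lia.
Qed.

End Basics.

(** * Saturated graphs without three leaves in different parts *)

Definition C4_free (T : finType) (G : sgraph T) : Prop :=
  forall u v a b, u != v -> a != b ->
    adj G u a -> adj G u b -> adj G v a -> adj G v b -> False.

(* For C4-free graphs with colour classes c, this is C4-saturation relative to
   the complete multipartite graph: the new edge uv closes the walk u a b v,
   which is a path as soon as u and v are not adjacent. *)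
Record partite_saturated (T : finType) (C : eqType) (c : T -> C)
    (G : sgraph T) : Prop := PartiteSaturated {
  psat_proper : forall u v, adj G u v -> c u != c v;
  psat_C4_free : C4_free G;
  psat_walk : forall u v, c u != c v -> ~~ adj G u v ->
    exists a b, [/\ adj G u a, adj G a b & adj G b v] }.

Definition leaves (T : finType) (G : sgraph T) : {set T} := [set v | deg G v == 1].

Section LowerBounds.

Variables (T : finType) (C : eqType) (c : T -> C) (G : sgraph T) (n : nat).
Hypothesis satG : partite_saturated c G.
Hypothesis card_class : forall v, #|[set w | c w == c v]| = n.
Hypothesis two_classes : forall v, exists w, c w != c v.

Let c_neq := psat_proper satG.
Let walk := psat_walk satG.
Let noC4 := psat_C4_free satG.
Local Notation leaves := (leaves G).

Lemma psat_nbhd_neq0 v : exists w, adj G v w.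
Proof.
have [w wv] := two_classes v; case: (boolP (adj G v w)) => [|vw]; first by exists w.
by case: (walk _ vw) => [|a [_ [va _ _]]]; [rewrite eq_sym | exists a].
Qed.

Lemma psat_deg_gt0 v : 0 < deg G v.
Proof.
by have [w vw] := psat_nbhd_neq0 v; apply/card_gt0P; exists w; rewrite in_nbhd.
Qed.

Lemma other_nbr v w : deg G v != 1 -> exists2 u, adj G v u & u != w.
Proof.
move=> dv1; have: 0 < #|nbhd G v :\ w|.
  have := psat_deg_gt0 v; move: dv1; rewrite /deg (cardsD1 w (nbhd G v)).
  by case: (w \in _); lia.
by case/card_gt0P => u; rewrite !inE => /andP[uw vu]; exists u.
Qed.

(** This is [tree_bound] for a breadth-first tree rooted at [x]. By the walk condition, vertices
    outside the part of [x] have level at most 3, so level 4 lies inside that part; this keeps the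
    exceptional set down to 2n + 1 vertices. *)
Lemma independent_nbhd_bound x :
    (forall s t, adj G x s -> adj G x t -> ~~ adj G s t) ->
    deg G x + #|leaves :\: [set v | [exists s, adj G x s && adj G s v]]| <= n + 1 ->
  3 * #|T| <= 2 * nedges G + 2 * n + 3.
Proof.
set NN := [set v | _] => indep_x few_leaves.
pose N3 := [set v | [exists p in NN, adj G p v]].
(* The breadth-first level; 4 stands for every vertex that is not reached within three steps. *)
pose l v := if v == x then 0 else if adj G x v then 1 else
  if v \in NN then 2 else if v \in N3 then 3 else 4.
have l_walk v : c v != c x -> l v <= 3.
  rewrite /l => cv; case: eqP => // _; case: ifP => // /negbT xv; case: ifP => // _.
  have [|a [b [xa ab bv]]] := walk _ xv; first by rewrite eq_sym.
  suff -> : v \in N3 by [].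
  rewrite inE; apply/existsP; exists b; rewrite bv andbT inE.
  by apply/existsP; exists a; rewrite xa.
have NNP v : reflect (exists2 s, adj G x s & adj G s v) (v \in NN).
  rewrite inE; apply: (iffP existsP) => [[s /andP[]]|[s xs sv]]; exists s => //.
  by rewrite xs.
have N3P v : reflect (exists2 s, s \in NN & adj G s v) (v \in N3).
  rewrite inE; apply: (iffP existsP) => [[s /andP[]]|[s xs sv]]; exists s => //.
  by rewrite xs.
have l_down v : v != x -> exists w, adj G v w && (l w < l v).
  move=> vx; case: (boolP (adj G x v)) => [xv|xv].
    by exists x; rewrite adjC xv /l eqxx (negPf vx) xv.
  case: (boolP (v \in NN)) => [vNN|vNN].
    have [s xs sv] := NNP _ vNN; exists s; rewrite adjC sv /l xs vNN.
    by rewrite (negPf vx) (negPf xv); case: ifP.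
  case: (boolP (v \in N3)) => [vN3|vN3].
    have [s xs sv] := N3P _ vN3; exists s; rewrite adjC sv /l vN3 xs.
    by rewrite (negPf vx) (negPf xv) (negPf vNN); case: ifP => //; case: ifP.
  have lv : l v = 4 by rewrite /l (negPf vx) (negPf xv) (negPf vNN) (negPf vN3).
  have cv : c v = c x.
    by apply/eqP; apply/contraT => /l_walk; rewrite lv.
  have [w vw] := psat_nbhd_neq0 v; exists w; rewrite vw lv ltnS l_walk //.
  by rewrite -cv eq_sym c_neq.
pose f v := odflt x [pick w | adj G v w && (l w < l v)].
have fP v : v != x -> adj G v (f v) /\ l (f v) < l v.
  by rewrite /f; case: pickP => [w /andP[] //|no /l_down[w]]; rewrite no.
have fx : f x = x.
  by rewrite /f; case: pickP => // w; rewrite /l eqxx ltn0 andbF.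
pose N4 := [set v | 3 < l v].
have N4c v : v \in N4 -> c v = c x.
  by rewrite inE => lv; apply/eqP; apply/contraT => /l_walk; rewrite leqNgt lv.
(* These vertices may lack a non-tree edge. The parents of [N4] are at most [#|N4|] in number, so
   together with the part of [x] outside [N4] they contribute at most [n]; the hypothesis bounds the
   other two sets by n + 1. *)
pose Bad := nbhd G x :|: ([set w | c w == c x] :\: N4) :|: f @: N4
  :|: (leaves :\: NN).
have child v w : f w = v -> w != x -> l v < l w.
  by move=> <- /fP[].
have := tree_bound (B := Bad) fx fP.
have cBad : #|Bad| <= 2 * n + 1.
  have U1 := leq_card_setU (nbhd G x :|: ([set w | c w == c x] :\: N4) :|: f @: N4)
    (leaves :\: NN).
  have U2 := leq_card_setU (nbhd G x :|: ([set w | c w == c x] :\: N4)) (f @: N4).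
  have U3 := leq_card_setU (nbhd G x) ([set w | c w == c x] :\: N4).
  have U4 := leq_imset_card f N4.
  have : #|N4| + #|[set w | c w == c x] :\: N4| = n.
    rewrite -(card_class x) -[RHS](cardsID N4); congr (_ + _).
    by apply: eq_card => v; rewrite !inE; case: (boolP (3 < l v)) => [lv|];
      rewrite ?andbF ?andbT // N4c ?eqxx // inE.
  move: few_leaves (leq_of_leqif U1) (leq_of_leqif U2) (leq_of_leqif U3) U4.
  by rewrite -/NN /deg /Bad; lia.
move=> tb; suff: 3 * #|T| <= 2 * nedges G + 2 + #|Bad|.
  by move: #|T| cBad => N; lia.
apply: tb => v; rewrite 3!in_setU !negb_or => /andP[/andP[/andP[xv cv] fv] lv].
have vx : v != x.
  by apply: contraNneq cv => ->; rewrite !inE eqxx /l eqxx.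
move: xv; rewrite in_nbhd => xv.
have l_ge2 : 1 < l v by rewrite /l (negPf vx) (negPf xv); case: ifP => //; case: ifP.
have lNN : l v != 2 -> v \notin NN.
  by apply: contraNN => vNN; rewrite /l (negPf vx) (negPf xv) vNN.
have nonleaf : l v != 2 -> deg G v != 1.
  by move=> /lNN vNN; move: lv; rewrite inE vNN inE.
have l_le4 w : l w <= 4 by rewrite /l; do 4!case: ifP => // _.
(* At level 4, [v] is not a leaf, and a second neighbour cannot be its child because no level
   exceeds 4. *)
case: (boolP (v \in N4)) => [|vN4].
  rewrite inE => lv3; have [|u vu ufv] := @other_nbr v (f v); first by apply: nonleaf; lia.
  exists u; split=> //; apply/eqP => fu.
  have [ux|/(child _ _ fu)] := eqVneq u x; last by have := l_le4 u; lia.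
  by move: vx; rewrite -fu ux fx eqxx.
have cvx : c v != c x by move: cv; rewrite in_setD vN4 inE.
(* At level 2, the walk of length 3 from [x] to [v] ends with a neighbour [w] of [v] that is again
   on level 2, because the neighbourhood of [x] is independent. An edge inside a level is not a tree
   edge. *)
case: (eqVneq (l v) 2) => [lv2|lv2].
  have [|s [w [xs sw wv]]] := walk _ xv; first by rewrite eq_sym.
  have wx : w != x by apply: contraNneq xv => <-.
  have xw : ~~ adj G x w by apply/negP => /(indep_x _ _ xs); rewrite sw.
  have lw : l w = 2.
    rewrite /l (negPf wx) (negPf xw); suff -> : w \in NN by [].
    by apply/NNP; exists s.
  exists w; rewrite adjC wv; split=> //; apply/eqP => Dw.
    by have [_] := fP _ vx; rewrite -Dw lw lv2.
  by have := child _ _ Dw wx; rewrite lw lv2.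
(* At level 3, a second neighbour that is a child of [v] would lie in [N4], and [v] would be one of
   the excluded parents. *)
have [|u vu ufv] := @other_nbr v (f v); first exact: nonleaf.
exists u; split=> //; apply/eqP => fu.
have [ux|/(child _ _ fu) luv] := eqVneq u x.
  by move: vx; rewrite -fu ux fx eqxx.
case/negP: fv; apply/imsetP; exists u => //; rewrite inE; lia.
Qed.

(** Split the vertices into a triangle [R] at a vertex [x] of degree 2, the other neighbours [P] of
    [a] and [b], and [rest]. The degrees of [a] and [b] provide one extra unit per vertex of [P],
    and [P] provides one unit per vertex of [Q]. Only vertices of the part of [x] stay below 3 on
    average, whence the term [n]. *)
Lemma min_deg2_bound :
    (forall v, 1 < deg G v) ->
    (forall w p q, deg G w = 2 -> adj G w p -> adj G w q -> p != q -> adj G p q) ->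
  3 * #|T| <= 2 * nedges G + n + 3.
Proof.
move=> deg2 triangle.
case: (pickP (fun v => deg G v == 2)) => [x /eqP dx|no2]; last first.
  rewrite -sum_deg -addnA; apply: leq_trans (leq_addr _ _).
  rewrite mulnC -sum_nat_const; apply: leq_sum => v _.
  by have := deg2 v; rewrite leq_eqVlt eq_sym no2.
have /cards2P[a [b [ab Nx]]] : #|nbhd G x| == 2 by rewrite -dx.
have xa : adj G x a by rewrite -in_nbhd Nx set21.
have xb : adj G x b by rewrite -in_nbhd Nx set22.
have adj_ab : adj G a b := triangle _ _ _ dx xa xb ab.
pose R := [set x; a; b].
pose P := (nbhd G a :\: R) :|: (nbhd G b :\: R).
pose rest := ~: (R :|: P).
pose Q := [set v in rest | (deg G v == 2) && (c v != c x)].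
have PR p : p \in P -> p \notin R by rewrite !inE => /orP[]/andP[].
have QR q : q \in Q -> q \notin R by rewrite !inE negb_or => /andP[/andP[]].
have QP q : q \in Q -> q \notin P by rewrite inE in_setC in_setU negb_or => /andP[/andP[]].
have parent p : p \in P -> exists2 s, s \in [set a; b] & adj G p s.
  by rewrite in_setU !in_setD !in_nbhd => /orP[]/andP[_]; rewrite adjC => ps;
    [exists a | exists b]; rewrite ?set21 ?set22.
have noQ q s : q \in Q -> s \in R -> ~~ adj G q s.
  move=> qQ; rewrite !inE -orbA => /or3P[]/eqP->; apply/negP; rewrite adjC -in_nbhd.
  - by rewrite Nx => qab; have := QR _ qQ; rewrite !inE in qab *; rewrite -orbA qab orbT.
  - by move=> aq; have := QP _ qQ; rewrite in_setU in_setD QR // aq.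
  - by move=> bq; have := QP _ qQ; rewrite in_setU !in_setD QR // bq orbT.
have QtoP q : q \in Q -> exists2 p, p \in P & adj G q p.
  move=> qQ; have cxq : c x != c q by move: qQ; rewrite inE => /and3P[_ _]; rewrite eq_sym.
  have [|s [p [xs sp pq]]] := walk cxq; first by rewrite adjC noQ // !inE eqxx.
  exists p; last by rewrite adjC.
  have pR : p \notin R by apply: contraTN pq => /(noQ _ _ qQ); rewrite adjC.
  rewrite in_setU !in_setD pR !in_nbhd /=.
  by have := xs; rewrite -in_nbhd Nx !inE => /orP[]/eqP <-; rewrite sp ?orbT.
(* The vertices of [P] that cannot pay for their neighbours in [Q] and still keep degree 2; the sum
   over [P] loses one unit for each of them. *)
pose Z := [set p in P | deg G p < 2 + #|nbhd G p :&: Q|].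
have deg_gtQ p : p \in P -> #|nbhd G p :&: Q| < deg G p.
  case/parent=> s sab ps; have sR : s \in R.
    by move: sab; rewrite !inE -orbA => ->; rewrite orbT.
  have sQ : s \notin Q by apply/negP => /QR; rewrite sR.
  apply: proper_card; rewrite properE subsetIl /=; apply/subsetPn.
  by exists s; rewrite ?in_nbhd // in_setI (negPf sQ) andbF.
(* Such a [p] has one neighbour in [R] and all its others in [Q]. By the triangle hypothesis the
   latter come in adjacent pairs [w], [q], with no neighbours besides each other and [p]. *)
have ZP p : p \in Z -> exists w q, [/\ nbhd G w = [set p; q], nbhd G q = [set p; w],
    adj G w q & [/\ w \in Q, q \in Q & forall r, adj G p r -> r \in Q :|: R]].
  rewrite inE => /andP[pP]; have [s sab ps] := parent _ pP; rewrite /deg => dp.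
  have sR : s \in R by move: sab; rewrite !inE -orbA => ->; rewrite orbT.
  have sQ : s \notin Q by apply/negP => /QR; rewrite sR.
  have Np : nbhd G p = s |: (nbhd G p :&: Q).
    apply/esym/eqP; rewrite eqEcard subUset subsetIl sub1set in_nbhd ps cardsU1.
    by rewrite in_setI (negPf sQ) andbF; lia.
  have pQR r : adj G p r -> r \in Q :|: R.
    rewrite -in_nbhd Np in_setU1 in_setI in_setU => /orP[/eqP->|/andP[_ ->//]].
    by rewrite sR orbT.
  have : 0 < #|nbhd G p :&: Q|.
    have := deg2 p; rewrite /deg {1}Np cardsU1 in_setI (negPf sQ) andbF; lia.
  case/card_gt0P => w; rewrite in_setI in_nbhd => /andP[pw wQ].
  have partner v : v \in Q -> adj G p v ->
      exists q, [/\ nbhd G v = [set p; q], q \in Q, adj G v q & adj G p q].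
    move=> vQ pv; have dv : deg G v = 2 by move: vQ; rewrite inE => /and3P[_ /eqP].
    have [q vq qp] : exists2 q, adj G v q & q != p by apply: other_nbr; rewrite dv.
    exists q; have pq : adj G p q.
      by apply: triangle dv _ vq _; rewrite 1?adjC 1?eq_sym.
    split=> //.
      apply/esym/eqP; rewrite eqEcard cards2 eq_sym qp -/(deg G v) dv andbT.
      by rewrite subUset !sub1set !in_nbhd vq adjC pv.
    have := pQR _ pq; rewrite in_setU => /orP[//|/(noQ _ _ vQ)].
    by rewrite vq.
  have [q [Nw qQ wq pq]] := partner _ wQ pw.
  exists w, q; split=> //; have [r [Nq _ _ _]] := partner _ qQ pq.
  have: w \in nbhd G q by rewrite in_nbhd adjC.
  by rewrite Nq !inE eq_sym (negPf (adj_neq pw)) => /eqP->.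
(* For two such vertices no edge joins the triangles [S] and [S'], hence no walk of length 3 leads
   from [w] or [q] to [w']. Then [w] and [q] both have the colour of [w'], although they are
   adjacent. *)
have Z_le1 : #|Z| <= 1.
  apply/card_le1_eqP => p p' pZ p'Z; apply/eqP/contraT => pp'.
  have pP : p \in P by move: pZ; rewrite inE => /andP[].
  have p'P : p' \in P by move: p'Z; rewrite inE => /andP[].
  have [w [q [Nw Nq wq [wQ qQ Np]]]] := ZP _ pZ.
  have [w' [q' [Nw' Nq' wq' [wQ' qQ' Np']]]] := ZP _ p'Z.
  pose S := [set p; w; q]; pose S' := [set p'; w'; q'].
  have pp'F : ~~ adj G p p'.
    by apply/negP => /Np; rewrite in_setU => /orP[/QP|];
      [rewrite p'P | rewrite (negPf (PR _ p'P))].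
  have QneP u v : u \in Q -> v \in P -> u != v.
    by move=> uQ vP; apply: contraTneq uQ => ->; apply/negP => /QP; rewrite vP.
  have wqP u : u \in [set w; q] ->
      [/\ u \in Q, adj G p u & forall v, adj G u v -> (v == p) || (v \in [set w; q])].
    rewrite !in_set2 => /orP[]/eqP->; (split=> //; last move=> v);
      rewrite ?[adj G p _]adjC -in_nbhd ?Nw ?Nq !in_set2 ?eqxx //;
      by case/orP=> ->; rewrite ?orbT.
  have wqP' u : u \in [set w'; q'] ->
      [/\ u \in Q, adj G p' u & forall v, adj G u v -> (v == p') || (v \in [set w'; q'])].
    rewrite !in_set2 => /orP[]/eqP->; (split=> //; last move=> v);
      rewrite ?[adj G p' _]adjC -in_nbhd ?Nw' ?Nq' !in_set2 ?eqxx //;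
      by case/orP=> ->; rewrite ?orbT.
  have wqF u : u \in [set w; q] -> adj G u p' -> False.
    case/wqP=> _ _ uP /uP; rewrite (negPf pp') /= => /wqP[/QneP].
    by move/(_ _ p'P); rewrite eqxx.
  have wqF' u : u \in [set w'; q'] -> adj G u p -> False.
    case/wqP'=> _ _ uP /uP; rewrite eq_sym (negPf pp') /= => /wqP'[/QneP].
    by move/(_ _ pP); rewrite eqxx.
  have noedge r s : r \in S -> s \in S' -> ~~ adj G r s.
    rewrite /S /S' -!setUA (in_setU1 r) (in_setU1 s) => rS sS'; apply/negP => rs.
    case/predU1P: rS => [Dr|rS]; case/predU1P: sS' => [Ds|sS'].
    - by move: pp'F; rewrite -Dr -Ds rs.
    - by apply: (wqF' _ sS'); rewrite adjC -Dr.
    - by apply: (wqF _ rS); rewrite -Ds.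
    have [_ _ /(_ _ rs)] := wqP _ rS; have [sQ p's _] := wqP' _ sS'.
    by rewrite (negPf (QneP _ _ sQ pP)) => /wqF; apply; rewrite adjC.
  have far u u' : u \in [set w; q] -> u' \in [set w'; q'] -> c u = c u'.
    move=> uwq uwq'; apply/eqP/contraT => cuu'.
    have uS : u \in S by rewrite /S -setUA in_setU uwq orbT.
    have uS' : u' \in S' by rewrite /S' -setUA in_setU uwq' orbT.
    have [|r [s [ur rs su]]] := walk cuu'; first exact: noedge.
    have rS : r \in S.
      rewrite -in_nbhd in ur; move: uwq ur; rewrite in_set2.
      by case/orP=> /eqP->; rewrite ?Nw ?Nq !inE => /orP[]->; rewrite ?orbT.
    have sS' : s \in S'.
      rewrite adjC -in_nbhd in su; move: uwq' su; rewrite in_set2.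
      by case/orP=> /eqP->; rewrite ?Nw' ?Nq' !inE => /orP[]->; rewrite ?orbT.
    by have := noedge _ _ rS sS'; rewrite rs.
  by have := c_neq wq; rewrite (far w w') ?(far q w') ?eqxx // !inE eqxx ?orbT.
have splitT F : \sum_v F v = \sum_(v in R) F v + \sum_(v in P) F v + \sum_(v in rest) F v.
  rewrite (sum_setC _ (R :|: P)) sum_setU //.
  by rewrite disjoint_sym disjoint_subset; apply/subsetP => v /PR.
have sumR : \sum_(v in R) deg G v >= #|P| + 6.
  have cP := leq_of_leqif (leq_card_setU (nbhd G a :\: R) (nbhd G b :\: R)).
  have xab : x \notin [set a; b] by rewrite !inE negb_or (adj_neq xa) (adj_neq xb).
  rewrite /R -setUA sum_setU ?big_set1; last by rewrite disjoints1.
  rewrite sum_setU ?big_set1 ?disjoints1 ?inE // dx.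
  have two s t : adj G s x -> adj G s t -> x != t -> t \in R ->
      #|nbhd G s :\: R| + 2 <= deg G s.
    move=> sx st xt tR; rewrite /deg -(cardsID R (nbhd G s)) addnC leq_add2r.
    have <- : #|[set x; t]| = 2 by rewrite cards2 xt.
    apply: subset_leq_card; rewrite subsetI !subUset !sub1set !in_nbhd sx st tR.
    by rewrite !inE eqxx.
  have da : #|nbhd G a :\: R| + 2 <= deg G a.
    by apply: (two a b); rewrite ?[adj G a x]adjC ?(adj_neq xb) // !inE eqxx orbT.
  have db : #|nbhd G b :\: R| + 2 <= deg G b.
    apply: (two b a); rewrite ?[adj G b _]adjC ?(adj_neq xa) //.
    by rewrite !inE eqxx !orbT.
  by move: cP; rewrite -/P; lia.
have sumP : \sum_(v in P) deg G v + 1 >= 2 * #|P| + #|Q|.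
  have : \sum_(v in P) (2 + #|nbhd G v :&: Q|) <= \sum_(v in P) (deg G v + (v \in Z)).
    apply: leq_sum => p pP; rewrite [p \in Z]inE pP /=.
    by case: ltnP => dp; have := deg_gtQ _ pP; lia.
  rewrite !big_split /= sum_nat_const -/(edge_count G P Q) edge_countC.
  have : #|Q| <= edge_count G Q P.
    rewrite -sum1_card; apply: leq_sum => q /QtoP[p pP qp].
    by apply/card_gt0P; exists p; rewrite in_setI in_nbhd qp.
  suff : \sum_(v in P) (v \in Z) <= 1 by lia.
  apply: leq_trans Z_le1; rewrite -big_mkcondr sum1dep_card.
  by apply: subset_leq_card; apply/subsetP => p; rewrite inE => /andP[].
(* A vertex of [rest] with degree 2 is in [Q] or in the part of [x]; at most n - 1 are of the second
   kind, since [x] itself is in [R]. *)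
have sumrest : \sum_(v in rest) deg G v + #|Q| + n >= 3 * #|rest| + 1.
  have : \sum_(v in rest) 3 <= \sum_(v in rest) (deg G v + (v \in Q) + (c v == c x)).
    apply: leq_sum => v vrest; rewrite [v \in Q]inE vrest /=.
    by have := deg2 v; case: eqP => [->|]; case: eqP => //=; lia.
  rewrite !big_split /= sum_nat_const.
  have -> : \sum_(v in rest) (v \in Q) = #|Q|.
    rewrite -big_mkcondr sum1dep_card; apply: eq_card => v.
    by rewrite inE; apply: andb_idl; rewrite inE => /andP[].
  suff : \sum_(v in rest) (c v == c x) + 1 <= n by lia.
   rewrite -big_mkcondr sum1dep_card -(card_class x) [X in _ <= X](cardsD1 x).
  rewrite inE eqxx addnC leq_add2l; apply: subset_leq_card.
  apply/subsetP => v; rewrite !inE => /andP[+ ->]; rewrite andbT.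
  by apply: contraNneq => ->; rewrite eqxx.
have -> : #|T| = 3 + #|P| + #|rest|.
  have := splitT (fun=> 1); rewrite !sum1_card => ->.
  by rewrite /R -setUA cardsU1 cards2 ab !inE negb_or (adj_neq xa) (adj_neq xb).
rewrite -sum_deg splitT; lia.
Qed.

Lemma leaf_nbr x y z : x \in leaves -> adj G x y -> adj G x z -> y = z.
Proof.
rewrite inE => /cards1P[w Nx]; rewrite -!in_nbhd Nx !inE.
by move=> /eqP-> /eqP->.
Qed.

(** A walk of length 3 between two leaves must pass through their supports. If the leaves are
    adjacent, each is the support of the other. *)
Lemma leaf_supports_adj x x' y y' : x \in leaves -> x' \in leaves ->
  adj G x y -> adj G x' y' -> c x != c x' -> adj G y y'.
Proof.
move=> xL x'L xy x'y' cxx'; case: (boolP (adj G x x')) => [xx'|xx'].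
  by rewrite (leaf_nbr xL xy xx') (leaf_nbr x'L x'y' (z := x)) adjC.
have [a [b [xa ab bx']]] := walk cxx' xx'.
rewrite (leaf_nbr xL xy xa) (leaf_nbr x'L x'y' (z := b)) //.
by rewrite adjC.
Qed.

(** Without leaves, [independent_nbhd_bound] at a vertex of degree 2 with non-adjacent neighbours or
    [min_deg2_bound] applies. With leaves, either [independent_nbhd_bound] applies at a leaf, or the
    supports of four leaves close a 4-cycle. *)
Lemma few_leaf_colours_bound :
    1 < n ->
    (forall x1 x2 x3, x1 \in leaves -> x2 \in leaves -> x3 \in leaves ->
       c x1 != c x2 -> c x1 != c x3 -> c x2 != c x3 -> False) ->
  3 * #|T| <= 2 * nedges G + 2 * n + 3.
Proof.
move=> n1 no3.
have [L0|[x xL]] := set_0Vmem leaves.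
  have deg2 v : 1 < deg G v.
    have := psat_deg_gt0 v; rewrite leq_eqVlt => /predU1P[dv|//].
    by have : v \in leaves by [rewrite inE -dv]; rewrite L0 inE.
  case: (pickP (fun x => (deg G x == 2) && [exists p, exists q,
      [&& adj G x p, adj G x q, p != q & ~~ adj G p q]])) => [x|triangle].
    case/andP=> /eqP dx /existsP[p /existsP[q /and4P[xp xq pq npq]]].
    have Nx : nbhd G x = [set p; q].
      apply/esym/eqP; rewrite eqEcard subUset !sub1set !in_nbhd xp xq.
      by rewrite cards2 pq -/(deg G x) dx.
    apply: (independent_nbhd_bound (x := x)).
      move=> s t; rewrite -!in_nbhd Nx !inE => /orP[]/eqP-> /orP[]/eqP->;
        by rewrite ?adjxx // adjC.
    by rewrite L0 set0D cards0 dx; lia.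
  have := min_deg2_bound deg2.
  suff tri w p q : deg G w = 2 -> adj G w p -> adj G w q -> p != q -> adj G p q.
    by move=> /(_ tri); move: #|T| => N; lia.
  move=> dw wp wq pq; apply/contraT => npq.
  have /negP[] := negbT (triangle w); rewrite dw eqxx /=.
  by apply/existsP; exists p; apply/existsP; exists q; rewrite wp wq pq.
have nbr v : exists w, adj G v w := psat_nbhd_neq0 v.
(* For a leaf [z], the leaves attached to another support than [z]. If they share one colour, they
   are at most [n], and with [deg G z] equal to 1 the bound n + 1 is met. *)
pose far z : {set T} := leaves :\: [set v | [exists s, adj G z s && adj G s v]].
have one_colour z : z \in leaves -> 
    (forall u v, u \in far z -> v \in far z -> c u = c v) ->
    3 * #|T| <= 2 * nedges G + 2 * n + 3.
  move=> zL zfar; apply: (independent_nbhd_bound (x := z)).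
    by move=> s t zs zt; rewrite (leaf_nbr zL zs zt) adjxx.
  move: (zL); rewrite inE => /eqP->; rewrite addnC leq_add2r -/(far z).
  have [->|[u uF]] := set_0Vmem (far z); first by rewrite cards0.
  rewrite -(card_class u); apply: subset_leq_card; apply/subsetP => v vF.
  by rewrite inE (zfar v u).
have far_or z : z \in leaves -> 3 * #|T| <= 2 * nedges G + 2 * n + 3 \/
    exists u v, [/\ u \in far z, v \in far z & c u != c v].
  move=> zL; case: (pickP (fun uv : T * T =>
      [&& uv.1 \in far z, uv.2 \in far z & c uv.1 != c uv.2])) => [[u v]|no].
    by move=> /and3P[/= uF vF cuv]; right; exists u, v.
  left; apply: one_colour zL _ => u v uF vF; apply/eqP.
  by have := no (u, v); rewrite /= uF vF /= => /negbFE.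
have farP z u y : u \in far z -> z \in leaves -> adj G z y -> u \in leaves /\ ~~ adj G y u.
  rewrite in_setD inE => /andP[zu uL] zL zy; split=> //.
  by apply: contraNN zu => yu; apply/existsP; exists y; rewrite zy.
have [//|[x2 [x3 [x2F x3F c23]]]] := far_or x xL.
(* Three leaves never show three colours, and [x2], [x3] differ in colour, so one of them has the
   colour of [x]. *)
wlog cx2 : x2 x3 x2F x3F c23 / c x2 = c x => [wlog_x2|].
  have [y xy] := nbr x.
  have [x2L _] := farP _ _ _ x2F xL xy; have [x3L _] := farP _ _ _ x3F xL xy.
  have [cx2|cx2] := eqVneq (c x2) (c x); first exact: (wlog_x2 x2 x3).
  have [cx3|cx3] := eqVneq (c x3) (c x).
    by apply: (wlog_x2 x3 x2); rewrite // eq_sym.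
  by case: (no3 x x2 x3); rewrite // eq_sym.
have [y xy] := nbr x; have [y2 xy2] := nbr x2; have [y3 xy3] := nbr x3.
have [x2L yx2] := farP _ _ _ x2F xL xy; have [x3L _] := farP _ _ _ x3F xL xy.
have [//|[x4 [x5 [x4F x5F c45]]]] := far_or x3 x3L.
wlog cx4 : x4 x5 x4F x5F c45 / c x4 != c x => [wlog_x4|].
  have [cx4|cx4] := eqVneq (c x4) (c x); last exact: (wlog_x4 x4 x5).
  by apply: (wlog_x4 x5 x4); rewrite // -?cx4 eq_sym.
have [y4 xy4] := nbr x4; have [x4L yx4] := farP _ _ _ x4F x3L xy3.
(* The colour of [x] and [x2] is avoided by [x3] and [x4], so both [y] and [y2] are adjacent to [y3]
   and [y4]. Farness of [x2] from [x] and of [x4] from [x3] makes the supports on each side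
   distinct. *)
case: (@noC4 y y2 y3 y4).
- by apply: contraNneq yx2 => ->; rewrite adjC.
- by apply: contraNneq yx4 => ->; rewrite adjC.
- by apply: leaf_supports_adj xy xy3 _; rewrite // -cx2.
- by apply: leaf_supports_adj xy xy4 _; rewrite // eq_sym.
- by apply: leaf_supports_adj xy2 xy3 _.
- by apply: leaf_supports_adj xy2 xy4 _; rewrite // cx2 eq_sym.
Qed.

(** * Three leaves in different parts *)

Section Triangle.
Variables (x y : 'I_3 -> T).
Hypothesis xL : forall i, x i \in leaves.
Hypothesis xy : forall i, adj G (x i) (y i).
Hypothesis cx : forall i j, i != j -> c (x i) != c (x j).

Let X := [set y i | i : 'I_3].

Lemma support_adj i j : i != j -> adj G (y i) (y j).
Proof. by move=> ij; apply: leaf_supports_adj (xy i) (xy j) (cx ij). Qed.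

Lemma support_inj : injective y.
Proof.
by move=> i j; apply: contra_eq => ij; apply: (adj_neq (support_adj ij)).
Qed.

Lemma support_in i : y i \in X.
Proof. exact: imset_f. Qed.

Lemma card_support : #|X| = 3.
Proof. by rewrite card_imset ?card_ord //; apply: support_inj. Qed.

Lemma third (i j : 'I_3) : exists k, (k != i) && (k != j).
Proof.
have : 0 < #|~: [set i; j]|.
  have := cardsC [set i; j]; rewrite cards2 card_ord; lia.
by case/card_gt0P=> k; rewrite !inE negb_or; exists k.
Qed.

(* A second neighbour in the triangle would close a 4-cycle through its third
   vertex. *)
Lemma hub_unique v i j : v \notin X -> adj G v (y i) -> adj G v (y j) -> i = j.
Proof.
move=> vX vi vj; apply/eqP/contraT => ij.
have [k /andP[ki kj]] := third i j.
case: (@noC4 v (y k) (y i) (y j)) => //; try exact: support_adj.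
  by apply: contraNneq vX => ->; apply: support_in.
by apply: contraNneq ij => /support_inj ->.
Qed.

Lemma leaf_notin_support v : v \in leaves -> v \notin X.
Proof.
move=> vL; apply/imsetP => -[i _ Dv].
have [j /andP[ji _]] := third i i; have [k /andP[ki kj]] := third i j.
have /support_inj Dj : y j = y k.
  by apply: (leaf_nbr vL); rewrite Dv support_adj // eq_sym.
by rewrite Dj eqxx in kj.
Qed.

(* The length-3 walk from the leaf x i to v leaves the triangle at y i. *)
Lemma walk_to_hub v i : v \notin X -> c v != c (x i) ->
  exists2 w, adj G w (y i) & adj G w v.
Proof.
move=> vX cvx; have xv : ~~ adj G (x i) v.
  by apply: contraNN vX => /(leaf_nbr (xL i) (xy i)) <-; apply: support_in.
have [|a [b [xa ab bv]]] := walk _ xv; first by rewrite eq_sym.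
by exists b; rewrite // (leaf_nbr (xL i) (xy i) xa) adjC.
Qed.

(** * Degree counting around the triangle *)

Let A := [set v in ~: X | [exists i, adj G v (y i)]].
Let B := ~: (X :|: A).

Let AP v : reflect (v \notin X /\ exists i, adj G v (y i)) (v \in A).
Proof.
rewrite [v \in A]inE in_setC.
by apply: (iffP andP) => -[vX /existsP].
Qed.

(** The default is taken only where no triangle vertex is adjacent; on [A] the index is forced by
    [hub_unique]. *)
Let hub v := odflt ord0 [pick i | adj G v (y i)].

Let hubE v i : v \notin X -> adj G v (y i) -> hub v = i.
Proof.
move=> vX vi; rewrite /hub; case: pickP => [j vj|/(_ i)]; last by rewrite vi.
exact: hub_unique vX vj vi.
Qed.

Let U := [set v in A | [forall w in A, adj G v w ==> (hub v != hub w)]].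

Let U_nbr v w : v \in U -> w \in A -> adj G v w -> hub v != hub w.
Proof. by rewrite inE => /andP[_ /forall_inP Uv] /Uv/implyP. Qed.

(** Otherwise [walk_to_hub] gives a common neighbour of [v] and [y i]. It lies outside the triangle
    because [v] has a single hub, so it is a neighbour in [A] with the same hub, which [U]
    forbids. *)
Let U_colour v i : v \in U -> adj G v (y i) -> c v = c (x i).
Proof.
move=> vU vi; have /AP[vX _] : v \in A by move: vU; rewrite inE => /andP[].
apply/eqP/contraT => /(walk_to_hub vX)[w wi wv].
have wX : w \notin X.
  apply/imsetP => -[j _ Dw]; have ji : j = i.
    by apply: (hub_unique vX _ vi); rewrite adjC -Dw.
  by move: wi; rewrite Dw ji adjxx.
have := @U_nbr v w vU; rewrite (hubE vX vi) (hubE wX wi) eqxx adjC wv.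
by apply=> //; apply/AP; split=> //; exists i.
Qed.

Let V i := [set v | c v == c (x i)].

Let disjXA : [disjoint X & A].
Proof.
by rewrite disjoint_sym disjoint_subset; apply/subsetP => v /AP[].
Qed.

Let disjXAB : [disjoint X :|: A & B].
Proof. by rewrite -setI_eq0 setICr. Qed.

(** Each degree is split over [X], [A] and [B]. The triangle yields 6, each vertex of [A] has
    exactly one neighbour in [X], and the edges from [X] to [A] and from [A] to [B] are counted from
    both ends; edges inside [B] are dropped. *)
Let degree_sum :
  2 * nedges G >= 6 + 2 * #|A| + edge_count G A A + 2 * edge_count G B A.
Proof.
have degS (S : {set T}) : \sum_(v in S) deg G v =
    edge_count G S X + edge_count G S A + edge_count G S B.
  by rewrite -edge_count_setT -(setUCr (X :|: A)) !edge_count_setU.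
have XX : edge_count G X X = 6.
  rewrite /edge_count (eq_bigr (fun=> 2)) => [|v /imsetP[i _ ->]].
    by rewrite sum_nat_const card_support.
  have -> : nbhd G (y i) :&: X = X :\ y i.
    apply/setP => w; rewrite in_setI in_setD1 in_nbhd andbC [RHS]andbC.
    case: (boolP (w \in X)) => //= /imsetP[j _ ->].
    apply/idP/idP => [/adj_neq|ji]; first by rewrite eq_sym.
    by apply: support_adj; apply: contraNneq ji => ->.
  by have := cardsD1 (y i) X; rewrite card_support support_in; lia.
have AX : edge_count G A X = #|A|.
  rewrite -sum1_card; apply: eq_bigr => v /AP[vX [i vi]].
  apply/eqP/cards1P; exists (y i); apply/setP => w; rewrite in_setI in_nbhd in_set1.
  apply/andP/eqP => [[vw /imsetP[j _ Dw]]|->]; last by rewrite vi support_in.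
  by rewrite Dw (hub_unique vX (i := i) (j := j)) // -Dw.
rewrite -sum_deg (sum_setC _ (X :|: A)) sum_setU // !degS XX (edge_countC _ X A) AX.
rewrite -/B (edge_countC _ A B); lia.
Qed.

Let card_T : #|T| = 3 + #|A| + #|B|.
Proof.
rewrite -(cardsC (X :|: A)) cardsU (disjoint_setI0 disjXA) cards0 card_support.
by rewrite subn0.
Qed.

(** Each [i] with a colour different from that of [b] yields a neighbour of [b] in [A] with hub [i];
    distinct hubs make these neighbours distinct. *)
Let B_nbrs b : b \in B -> #|[set i | c b != c (x i)]| <= #|nbhd G b :&: A|.
Proof.
rewrite in_setC in_setU negb_or => /andP[bX bA].
apply: leq_trans (leq_imset_card hub _); apply: subset_leq_card.
apply/subsetP => i; rewrite inE => /(walk_to_hub bX)[w wi wb].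
have wX : w \notin X.
  apply: contraNN bA => /imsetP[j _ Dw]; apply/AP; split=> //.
  by exists j; rewrite adjC -Dw.
apply/imsetP; exists w; last by rewrite (hubE wX wi).
by rewrite in_setI in_nbhd adjC wb; apply/AP; split=> //; exists i.
Qed.

Let BA_ge2 : 2 * #|B| <= edge_count G B A.
Proof.
rewrite mulnC -sum_nat_const; apply: leq_sum => b /B_nbrs; apply: leq_trans.
have := cardsC [set i | c b != c (x i)]; rewrite card_ord.
suff : #|~: [set i | c b != c (x i)]| <= 1 by lia.
apply/card_le1_eqP => i j; rewrite !inE !negbK => /eqP bi /eqP bj.
by apply/eqP; apply: contraT => /cx; rewrite -bi -bj eqxx.
Qed.

Let BA_ge : \sum_i (#|B| - #|B :&: V i|) <= edge_count G B A.
Proof.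
apply: (@leq_trans (\sum_(b in B) #|[set i | c b != c (x i)]|)); last first.
  exact: leq_sum.
rewrite (eq_bigr (fun b => \sum_i (c b != c (x i) : nat))) => [|b _]; last first.
  by rewrite -big_mkcond sum1dep_card.
rewrite exchange_big; apply: leq_sum => i _.
rewrite -(cardsID (V i) B) addKn -big_mkcondr sum1dep_card.
by apply: subset_leq_card; apply/subsetP => b; rewrite !inE andbC.
Qed.

Let UB_le i : #|U :&: V i| + #|B :&: V i| <= n.
Proof.
rewrite -(card_class (x i)) -/(V i) -(cardsID A (V i)) leq_add //.
  apply: subset_leq_card; apply/subsetP => v; rewrite !in_setI [v \in U]inE.
  by case/andP=> /andP[-> _] ->.
apply: subset_leq_card; apply/subsetP => v; rewrite in_setI in_setD in_setC in_setU negb_or.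
by case/andP=> /andP[_ ->] ->.
Qed.

Let U_le : #|U| <= \sum_i #|U :&: V i|.
Proof.
rewrite -sum1_card; apply: (@leq_trans (\sum_(v in U) \sum_i (v \in V i : nat))).
  apply: leq_sum => v vU; have /AP[vX [i vi]] : v \in A by move: vU; rewrite inE => /andP[].
  by rewrite (bigD1 i) //= inE (U_colour vU vi) eqxx.
rewrite exchange_big; apply: leq_sum => i _; rewrite -big_mkcondr sum1dep_card.
by apply: subset_leq_card; apply/subsetP => v; rewrite in_setI inE.
Qed.

Let A_mate v : v \in A -> v \notin U -> exists w, [/\ w \in A, adj G v w & hub v = hub w].
Proof.
move=> vA; rewrite inE vA negb_forall_in => /exists_inP[w wA].
by rewrite negb_imply negbK => /andP[vw /eqP]; exists w.
Qed.

Let A_nbr v : v \in A -> 1 <= #|nbhd G v :&: A| + (v \in U).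
Proof.
move=> vA; case: (boolP (v \in U)) => [_|/(A_mate vA)[w [wA vw _]]]; first by rewrite addn1.
by rewrite addn0; apply/card_gt0P; exists w; rewrite in_setI in_nbhd vw.
Qed.

Let sum_U : \sum_(v in A) (v \in U : nat) = #|U|.
Proof.
rewrite -big_mkcondr sum1dep_card; apply: eq_card => v; rewrite inE.
by apply: andb_idl; rewrite inE => /andP[].
Qed.

Let AA_ge : #|A| <= edge_count G A A + #|U|.
Proof.
rewrite -sum_U -big_split -sum1_card; exact: leq_sum.
Qed.

(** Both ends of an edge between different hubs count twice: through that edge, and through either
    membership in [U] or a further neighbour with the same hub. *)
Let AA_cross v w : v \in A -> w \in A -> adj G v w -> hub v != hub w ->
  #|A| + 2 <= edge_count G A A + #|U|.
Proof.
have two u u' : u \in A -> u' \in A -> adj G u u' -> hub u != hub u' ->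
    2 <= #|nbhd G u :&: A| + (u \in U).
  move=> uA u'A uu' hu; case: (boolP (u \in U)) => [_|/(A_mate uA)[m [mA um hm]]].
    by rewrite addn1 ltnS; apply/card_gt0P; exists u'; rewrite in_setI in_nbhd uu'.
  have <- : #|[set m; u']| = 2.
    by rewrite cards2; case: eqP => // Dm; rewrite hm Dm eqxx in hu.
  rewrite addn0; apply: subset_leq_card.
  by rewrite subUset !sub1set !in_setI !in_nbhd um uu' mA.
move=> vA wA vw hvw; have vwn := adj_neq vw.
rewrite -sum_U -big_split /= (big_setD1 v) //= (big_setD1 w) /=; last first.
  by rewrite in_setD1 wA eq_sym vwn.
have := two _ _ vA wA vw hvw.
have := two _ _ wA vA; rewrite adjC eq_sym => /(_ vw hvw).
have : \sum_(u in A :\ v :\ w) 1 <=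
    \sum_(u in A :\ v :\ w) (#|nbhd G u :&: A| + (u \in U)).
  by apply: leq_sum => u; rewrite !in_setD => /and3P[_ _ /A_nbr].
rewrite sum1_card; have := cardsD1 v A; have := cardsD1 w (A :\ v).
rewrite in_setD1 eq_sym vwn vA wA /=; lia.
Qed.

Let U_leaf : (forall v w, v \in A -> w \in A -> adj G v w -> hub v = hub w) ->
  B = set0 -> U \subset leaves.
Proof.
move=> cross B0; apply/subsetP => v vU.
have vA : v \in A by move: vU; rewrite inE => /andP[].
have /AP[vX [i vi]] := vA.
rewrite inE; apply/cards1P; exists (y i); apply/setP => w; rewrite in_nbhd in_set1.
apply/idP/eqP => [vw|->//]; have : w \notin B by rewrite B0 inE.
rewrite in_setC negbK in_setU => /orP[/imsetP[j _ Dw]|wA].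
  by rewrite Dw (hub_unique vX (i := i) (j := j)) // -Dw.
by have := U_nbr vU wA vw; rewrite (cross v w) ?eqxx.
Qed.

(** Of the two copies of [edge_count G B A] in [degree_sum], one is bounded by 2|B|. The other is
    bounded by 3|B| minus the sizes of the [B :&: V i], and these cancel against [UB_le], since [U]
    and [B] compete for room in the parts [V i]. *)
Let counting : 2 * nedges G + 3 * n >=
  3 * #|A| + 6 + 5 * #|B| + (edge_count G A A + #|U| - #|A|).
Proof.
have : \sum_i (#|U :&: V i| + #|B :&: V i|) <= 3 * n.
  apply: leq_trans (_ : \sum_(i < 3) n <= _); first by apply: leq_sum => i _; apply: UB_le.
  by rewrite sum_nat_const card_ord.
have : \sum_i (#|B| - #|B :&: V i|) + \sum_i #|B :&: V i| = 3 * #|B|.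
  rewrite -big_split /= (eq_bigr (fun=> #|B|)) ?sum_nat_const ?card_ord // => i _.
  by rewrite subnK // subset_leq_card // subsetIl.
rewrite big_split /=; move: degree_sum BA_ge2 BA_ge U_le AA_ge.
move: (\sum_i (#|B| - _)) (\sum_i #|U :&: _|) (\sum_i #|B :&: _|) => s1 s2 s3; lia.
Qed.

Lemma triangle_bound : 3 * #|T| <= 2 * nedges G + 3 * n + 3.
Proof. by rewrite card_T; move: counting; lia. Qed.

(** The hypothesis leaves a slack of 1 in [counting], while a vertex of [B] or an edge between
    different hubs would each cost 2. *)
Lemma triangle_extremal : 2 * nedges G + 3 * n + 2 <= 3 * #|T| ->
  [/\ forall v, v \notin X -> exists i, adj G v (y i),
      forall v w i, v \notin X -> w \notin X -> adj G v w -> adj G v (y i) ->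
        adj G w (y i)
    & 3 * n <= #|leaves| + 1].
Proof.
rewrite card_T => small; have /eqP := counting.
have B0 : B = set0 by apply: cards0_eq; move: counting small; lia.
have inA v : v \notin X -> v \in A.
  move=> vX; have : v \notin B by rewrite B0 inE.
  by rewrite in_setC negbK in_setU (negPf vX).
have cross v w : v \in A -> w \in A -> adj G v w -> hub v = hub w.
  move=> vA wA vw; apply/eqP/contraT => /(AA_cross vA wA vw).
  by move: counting small; lia.
split=> [v /inA/AP[] //|v w i vX wX vw vi|].
  have /AP[_ [j wj]] := inA w wX.
  by have := cross _ _ (inA v vX) (inA w wX) vw; rewrite (hubE vX vi) (hubE wX wj) => ->.
have := subset_leq_card (U_leaf cross B0); move: degree_sum small BA_ge2 AA_ge.
by rewrite B0 cards0; lia.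
Qed.

(** Neighbours outside the triangle share their hub, so a second one besides [w] would give a
    4-cycle through that hub. Hence the non-leaves outside the triangle are perfectly matched. *)
Lemma triangle_Y_structure (W : nat -> {set T}) :
    (forall v, v \notin X -> exists i, adj G v (y i)) ->
    (forall v w i, v \notin X -> w \notin X -> adj G v w -> adj G v (y i) ->
       adj G w (y i)) ->
    (forall i (hi : i < 3) v, v \in W i.+1 -> v \in leaves /\ adj G v (y (Ordinal hi))) ->
  Y_structure G W (~: leaves).
Proof.
move=> hubs mates WP; pose z i := y (inord i.-1).
have zE (i : 'I_3) : z i.+1 = y i by rewrite /z /= inord_val.
have XE : [set z 1; z 2; z 3] = X.
  apply/setP => v; rewrite 2!in_setU !in_set1; apply/idP/idP => [|/imsetP[i _ ->]].
    by rewrite -orbA => /or3P[]/eqP->; apply: support_in.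
  by rewrite -zE; case: i => [[|[|[|]]]] //= _; rewrite eqxx ?orbT.
have V_nbrs u : u \in ~: leaves :\: X -> exists i w,
    [/\ w \in ~: leaves :\: X, nbhd G u = [set y i; w], adj G w (y i) & u != w].
  rewrite in_setD in_setC => /andP[uX uL]; have [i ui] := hubs u uX.
  have [|w uw wi] := other_nbr (v := u) (y i).
    by apply: contraNN uL; rewrite inE.
  have wX : w \notin X.
    apply/imsetP => -[j _ Dw]; case/eqP: wi.
    by rewrite Dw (hub_unique uX (i := i) (j := j)) // -Dw.
  have wyi := mates u w i uX wX uw ui.
  have uy : u != y i by apply: contraNneq uX => ->; apply: support_in.
  exists i, w; split=> //; last exact: adj_neq uw.
    rewrite in_setD wX in_setC; apply/negP => wL.
    by have := leaf_nbr wL wyi (z := u); rewrite adjC uw => /(_ isT) Du; rewrite Du eqxx in uy.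
  apply/setP => t; rewrite in_nbhd !inE; apply/idP/orP => [ut|[]/eqP-> //].
  have [->|ti] := eqVneq t (y i); [by left | right; apply/contraT => tw].
  have tX : t \notin X.
    apply/imsetP => -[j _ Dt]; case/eqP: ti.
    by rewrite Dt (hub_unique uX (i := i) (j := j)) // -Dt.
  have tyi := mates u t i uX tX ut ui.
  (* Here [u] and [y i] would have the two common neighbours [t] and [w]. *)
  by case: (noC4 uy tw); rewrite // adjC.
have XV v : v \in X -> v \notin ~: leaves :\: X by rewrite in_setD => ->.
have NV u : u \in ~: leaves :\: X -> #|nbhd G u :&: (~: leaves :\: X)| = 1.
  move=> uV; have [i [w [wV Nu _ _]]] := V_nbrs u uV.
  apply/eqP/cards1P; exists w; apply/setP => t; rewrite in_setI Nu in_set2 in_set1.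
  have [->|_] /= := eqVneq t (y i); last by apply: andb_idr => /eqP->.
  rewrite (negPf (XV _ (support_in i))); apply/esym/eqP => Dw.
  by have := XV _ (support_in i); rewrite Dw wV.
exists z; rewrite /= XE; split=> //.
- split; last split; last 1 first.
  + move=> _ _ /imsetP[i _ ->] /imsetP[j _ ->] ij.
    by apply: support_adj; apply: contraNneq ij => ->.
  + by apply/subsetP => v; rewrite in_setC; apply: contraL => /leaf_notin_support.
  + exact: card_support.
- case=> [|i] v //= hi /(WP i hi)[vL vi].
  apply/setP => w; rewrite in_nbhd in_set1 -[i.+1]/(Ordinal hi).+1 zE.
  by apply/idP/eqP => [vw|->//]; apply: leaf_nbr vL _ _.
- move=> u uV; have [i [w [wV Nu wi uw]]] := V_nbrs u uV.
  have yw : y i != w.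
    by apply: contraNneq (XV _ (support_in i)) => ->.
  split; [by rewrite /deg Nu cards2 yw | | exact: NV].
  apply/eqP/cards1P; exists (y i); apply/setP => t; rewrite in_setI Nu in_set2 in_set1.
  have [->|_] /= := eqVneq t (y i); first exact: support_in.
  by apply/andP => -[/eqP-> wX]; have := XV _ wX; rewrite wV.
move=> u v uV vV uv; have [i [w [wV Nu wi uw]]] := V_nbrs u uV.
have Dv : v = w.
  move: uv; rewrite -in_nbhd Nu in_set2 => /orP[]/eqP // Dv.
  by have := XV _ (support_in i); rewrite -Dv vV.
split; first by apply/set0Pn; exists (y i); rewrite in_setI Nu set21 in_nbhd Dv.
apply/subsetP => t; rewrite in_setI Nu in_set2 => /andP[/orP[/eqP->|/eqP->]].
  by rewrite support_in.
by rewrite -Dv in_nbhd adjxx.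
Qed.

End Triangle.

End LowerBounds.

(** * Graphs with the Y-structure are saturated *)

Section HubGraphs.
Variables (T : finType) (G : sgraph T) (W : nat -> {set T}) (P : {set T}).
Hypothesis PE : P = ~: (W 1 :|: W 2 :|: W 3).
Hypothesis YG : Y_structure G W P.

(* Outside the triangle X, z is the hub of v and m the other end of the matching
   edge at v. *)
Lemma Y_hubs : exists2 X : {set T},
    [/\ #|X| = 3, X \subset P & forall u v, u \in X -> v \in X -> u != v -> adj G u v] &
    forall v, v \notin X -> exists2 z, z \in X &
      (exists2 i, nbhd G v = [set z] & [/\ v \notin P, 0 < i <= 3, v \in W i &
        forall u, u \notin P -> nbhd G u = [set z] -> u \in W i]) \/
      (v \in P /\ exists m, [/\ m \notin X, nbhd G v = [set z; m] & nbhd G m = [set z; v]]).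
Proof.
have [y /= [[XP [cX adjX]] WY VY _ VV]] := YG.
set X := [set y 1; y 2; y 3] in XP cX adjX VY VV.
exists X => // v vX; case: (boolP (v \in P)) => [vP|vP].
  have vV : v \in P :\: X by rewrite in_setD vX.
  have [dv /eqP/cards1P[z Nz] /eqP/cards1P[m Nm]] := VY v vV.
  have [] : z \in nbhd G v :&: X /\ m \in nbhd G v :&: (P :\: X) by rewrite Nz Nm !set11.
  rewrite !in_setI !in_nbhd => /andP[vz zX] /andP[vm mV].
  have mX : m \notin X by move: mV; rewrite in_setD => /andP[].
  have zm : z != m by apply: contraNneq mX => <-.
  have Nv : nbhd G v = [set z; m].
    apply/esym/eqP; rewrite eqEcard subUset !sub1set !in_nbhd vz vm.
    by rewrite cards2 zm -/(deg G v) dv.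
  have [dm _ _] := VY m mV.
  have [/set0Pn[t tvm] /subsetP/(_ t tvm) tX] := VV v m vV mV vm.
  have tz : t = z.
    move: tvm; rewrite in_setI Nv !inE -in_nbhd => /andP[/orP[]/eqP// Dt].
    by rewrite Dt (negPf mX) in tX.
  exists z => //; right; split=> //; exists m; split=> //.
  apply/esym/eqP; rewrite eqEcard subUset !sub1set !in_nbhd cards2 -/(deg G m) dm.
  have zv : z != v by apply: contraNneq vX => <-.
  by move: tvm; rewrite in_setI tz !in_nbhd zv [adj G m v]adjC vm => /andP[_ ->].
have injy i j : 1 <= i <= 3 -> 1 <= j <= 3 -> y i = y j -> i = j.
  move: cX; rewrite /X -setUA cardsU1 cards2 in_set2.
  case: eqP => // y12; case: eqP => // y13; case: eqP => // y23 _.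
  by case: i => [|[|[|[|?]]]]; case: j => [|[|[|[|?]]]] // _ _ yij;
    first [case: (y12 yij) | case: (y13 yij) | case: (y23 yij) | case: (y12 (esym yij))
          | case: (y13 (esym yij)) | case: (y23 (esym yij))].
have inX i : 1 <= i <= 3 -> y i \in X.
  by case: i => [|[|[|[|]]]] //; rewrite !inE eqxx ?orbT.
have inW u : u \notin P -> exists2 i, 1 <= i <= 3 & u \in W i.
  by rewrite PE in_setC negbK !in_setU -orbA => /or3P[]; [exists 1 | exists 2 | exists 3].
have [i hi vW] := inW v vP; exists (y i); first exact: inX.
left; exists i; first exact: WY.
split=> // u /inW[j hj uW]; rewrite (WY _ _ hj uW) => /set1_inj Dy.
by rewrite -(injy j i).
Qed.

(** Every vertex outside the triangle has one edge to it, counted from both ends; the triangle adds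
    6 and the matching on [P :\: X] adds |P| - 3 to the degree sum. *)
Lemma Y_nedges : 2 * nedges G + 3 + #|~: P| = 3 * #|T|.
Proof.
have [X [cX XP adjX] hubX] := Y_hubs.
have degC v : v \in ~: X -> deg G v = 1 + (v \in P).
  rewrite in_setC => vX; rewrite /deg.
  have [z zX [[i -> [vP _ _ _]]|[vP [m [mX -> _]]]]] := hubX v vX.
    by rewrite cards1 (negPf vP).
  by rewrite cards2 vP; case: eqP mX => // <-; rewrite zX.
have CX : edge_count G (~: X) X = #|~: X|.
  rewrite -sum1_card; apply: eq_bigr => v; rewrite in_setC => vX.
  apply/eqP/cards1P; have [z zX hv] := hubX v vX; exists z.
  apply/setP => w; rewrite in_setI in_set1 andbC.
  have [wX|wX] /= := boolP (w \in X); last by apply/esym/eqP => Dw; rewrite Dw zX in wX.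
  case: hv => [[i -> _]|[_ [m [mX -> _]]]]; rewrite !inE //.
  by case: (eqVneq w m) mX => [<-|]; rewrite ?wX ?orbF.
have XX : edge_count G X X = 6.
  rewrite /edge_count (eq_bigr (fun=> 2)) => [|v vX]; first by rewrite sum_nat_const cX.
  have -> : nbhd G v :&: X = X :\ v.
    apply/setP => w; rewrite in_setI in_setD1 in_nbhd.
    have [wX|wX] := boolP (w \in X); rewrite ?andbF // !andbT eq_sym.
    by apply/idP/idP => [/adj_neq|]; last exact: adjX.
  by have := cardsD1 v X; rewrite cX vX; lia.
rewrite -sum_deg (sum_setC _ X) -edge_count_setT -(setUCr X) edge_count_setU; last first.
  by rewrite -setI_eq0 setICr.
rewrite XX (edge_countC _ X) CX (eq_bigr _ degC) big_split /= sum1_card.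
rewrite -big_mkcondr sum1dep_card.
have <- : #|P :\: X| = #|[set v | (v \in ~: X) && (v \in P)]|.
  by apply: eq_card => v; rewrite !inE.
have := cardsD P X; rewrite (setIidPr XP) cX => ->.
have := subset_leq_card XP; have := cardsC X; have := cardsC P; rewrite cX.
move: #|T| => N; lia.
Qed.

Variables (C : eqType) (c : T -> C).
Hypothesis proper : forall u v, adj G u v -> c u != c v.
Hypothesis W_class : forall i u v, 0 < i <= 3 -> u \in W i -> v \in W i -> c u = c v.

Lemma Y_saturated : partite_saturated c G.
Proof.
have [X [cX _ adjX] hubX] := Y_hubs.
split=> //.
  (* A vertex [u] outside [X] lies on no 4-cycle: it would need both neighbours [z] and [m], but [m]
     is adjacent only to [z] and [u], and [z] is not adjacent to itself. *)
  have half u v a b : u \notin X -> u != v -> a != b -> adj G u a -> adj G u b ->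
      adj G v a -> adj G v b -> False.
    move=> uX uv ab; rewrite -!in_nbhd.
    have [z zX [[i Nu _]|[_ [m [mX Nu Nm]]]]] := hubX u uX; rewrite Nu !inE.
      by move=> /eqP Da /eqP Db; rewrite Da Db eqxx in ab.
    have key : adj G v z -> adj G v m -> False.
      rewrite (adjC _ v m) -(in_nbhd _ m) Nm !inE [v == u]eq_sym (negPf uv) orbF => vz /eqP Dv.
      by rewrite Dv adjxx in vz.
    by case/orP=> /eqP Da; case/orP=> /eqP Db; move: ab; rewrite Da Db ?eqxx // => _ va vb;
      apply: key.
  move=> u v a b uv ab ua ub va vb.
  case: (boolP (u \in X)) => [uX|/half]; last by apply; eassumption.
  case: (boolP (v \in X)) => [vX|/half]; last by apply; rewrite 1?eq_sym; eassumption.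
  have C' := adjC G.
  case: (boolP (a \in X)) => [aX|/half]; last first.
    by move/(_ b u v ab uv); apply; rewrite C'.
  case: (boolP (b \in X)) => [bX|/half]; last first.
    by rewrite eq_sym in ab; move/(_ a u v ab uv); apply; rewrite C'.
  (* A 4-cycle inside [X] would need four distinct vertices among three. *)
  have := cardsD1 u X; rewrite (cardsD1 v (X :\ u)).
  rewrite (cardsD1 a (X :\ u :\ v)) (cardsD1 b (_ :\ a)).
  rewrite !in_setD1 uX vX aX bX cX [v == u]eq_sym uv [a == v]eq_sym (adj_neq va).
  rewrite [a == u]eq_sym (adj_neq ua) [b == v]eq_sym (adj_neq vb) [b == u]eq_sym (adj_neq ub).
  by rewrite [b == a]eq_sym ab; lia.
move=> u v cuv nuv; have uv : u != v by apply: contraNneq cuv => ->.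
have third s t : s \in X -> t \in X -> s != t -> exists r, adj G s r && adj G r t.
  move=> sX tX st; have := cardsD1 s X; rewrite (cardsD1 t (X :\ s)).
  rewrite in_setD1 sX tX eq_sym st cX.
  case: (posnP #|X :\ s :\ t|) => [->//|/card_gt0P[r]].
  rewrite !in_setD1 => /and3P[rt rs rX] _; exists r.
  by rewrite !adjX // eq_sym.
have [uX|uX] := boolP (u \in X); have [vX|vX] := boolP (v \in X).
- by rewrite adjX in nuv.
- have [z zX vz] : exists2 z, z \in X & adj G v z.
    by have [z zX [[i Nv _]|[_ [m [_ Nv _]]]]] := hubX v vX;
      exists z; rewrite // -in_nbhd Nv !inE eqxx.
  have [|r /andP[ur rz]] := third u z uX zX; last by exists r, z; rewrite (adjC _ z v).
  by apply: contraNneq nuv => ->; rewrite adjC.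
- have [z zX uz] : exists2 z, z \in X & adj G u z.
    by have [z zX [[i Nv _]|[_ [m [_ Nv _]]]]] := hubX u uX;
      exists z; rewrite // -in_nbhd Nv !inE eqxx.
  have [|r /andP[zr rv]] := third z v zX vX; last by exists z, r.
  by apply: contraNneq nuv => <-.
have [z zX Cu] := hubX u uX; have [z' z'X Cv] := hubX v vX.
have uz : adj G u z.
  by case: Cu => [[i Nu _]|[_ [m [_ Nu _]]]]; rewrite -in_nbhd Nu !inE eqxx.
have vz : adj G v z'.
  by case: Cv => [[i Nv _]|[_ [m [_ Nv _]]]]; rewrite -in_nbhd Nv !inE eqxx.
(* Different hubs give the walk [u], [z], [z'], [v]. With a common hub [z], a matched end allows a
   detour through its mate, and two pendant vertices lie in the same part. *)
have [Dz|zz'] := eqVneq z z'; last first.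
  by exists z, z'; rewrite (adjC _ z' v); split=> //; apply: adjX.
rewrite -{}Dz in Cv vz *.
case: Cu => [[i Nu [uP hi uW uWi]]|[_ [m [_ Nu Nm]]]]; last first.
  by exists m, z; rewrite (adjC _ z v) -in_nbhd Nu -(in_nbhd _ m) Nm !inE !eqxx orbT.
case: Cv => [[j Nv [vP _ _ _]]|[_ [m [_ Nv Nm]]]].
  by case/eqP: cuv; apply: W_class hi uW (uWi v vP Nv).
by exists z, m; rewrite uz (adjC _ z m) (adjC _ m v) -!in_nbhd Nm Nv !inE !eqxx orbT.
Qed.

End HubGraphs.

(** * Saturation relative to the complete multipartite graph *)

Lemma set2_eq (T : finType) (u v a b : T) : [set u; v] = [set a; b] ->
  u = a /\ v = b \/ u = b /\ v = a.
Proof.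
move=> E; have: u \in [set a; b] by rewrite -E set21.
have: v \in [set a; b] by rewrite -E set22.
have: a \in [set u; v] by rewrite E set21.
have: b \in [set u; v] by rewrite E set22.
rewrite !inE.
by do 4!case/orP=> /eqP ?; subst; auto.
Qed.

Lemma adj_graph_of (T : finType) (E : {set {set T}}) u v :
  adj (graph_of E) u v = (u != v) && ([set u; v] \in E).
Proof. by rewrite /adj /= in_setI inE cards2 andbC; case: (u != v). Qed.

Lemma adj_complete_multipartite k n (u v : 'I_k * 'I_n) :
  adj (complete_multipartite k n) u v = (u.1 != v.1).
Proof.
rewrite adj_graph_of; apply/andP/idP => [[_ /imsetP[[a b] /= ab /set2_eq]]|uv].
  by rewrite inE /= in ab; case=> -[-> ->] //; rewrite eq_sym.
split; first by apply: contraNneq uv => ->.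
by apply/imsetP; exists (u, v); rewrite ?inE.
Qed.

Lemma contains_C4P (T : finType) (H : sgraph T) :
  reflect (exists u a v b, [/\ u != v, a != b &
             [/\ adj H u a, adj H a v, adj H v b & adj H b u]])
    (contains H (cycle_graph 4)).
Proof.
pose o i (hi : i < 4) : 'I_4 := Ordinal hi.
have adjS (i : 'I_4) : adj (cycle_graph 4) i (ordS i).
  rewrite adj_graph_of; apply/andP; split; first by case: i => [[|[|[|[|]]]]].
  by apply/imsetP; exists i.
apply: (iffP existsP) => [[f /andP[/injectiveP injf /forallP adjf]]|].
  have fS i : adj H (f i) (f (ordS i)) := implyP (forallP (adjf i) _) (adjS i).
  exists (f (@o 0 isT)), (f (@o 1 isT)), (f (@o 2 isT)), (f (@o 3 isT)).
  split; rewrite ?(inj_eq injf) //.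
  by split; [have := fS (@o 0 isT) | have := fS (@o 1 isT) | have := fS (@o 2 isT)
            | have := fS (@o 3 isT)]; congr (adj _ (f _) (f _)); apply: val_inj.
move=> [u [a [v [b [uv ab [ua av vb bu]]]]]].
pose s := [:: u; a; v; b].
have us : uniq s.
  rewrite /= !inE !negb_or uv ab (adj_neq ua) (adj_neq av) (adj_neq vb).
  by rewrite eq_sym (adj_neq bu).
pose f := [ffun i : 'I_4 => nth u s i].
have fS i : adj H (f i) (f (ordS i)).
  by rewrite !ffunE; case: i => [[|[|[|[|]]]]].
exists f; apply/andP; split.
  apply/injectiveP => i j; rewrite !ffunE => /eqP.
  by rewrite nth_uniq // => /eqP/val_inj.
apply/forallP => i; apply/forallP => j; apply/implyP.
rewrite adj_graph_of => /andP[_ /imsetP[l _ /set2_eq[][-> ->] //]].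
by rewrite adjC.
Qed.

Lemma C4_freeE (T : finType) (H : sgraph T) :
  C4_free H <-> ~~ contains H (cycle_graph 4).
Proof.
split=> [noC4|/contains_C4P noC4 u v a b uv ab ua ub va vb].
  apply/contains_C4P => -[u [a [v [b [uv ab [ua av vb bu]]]]]].
  by apply: (noC4 u v a b); rewrite // adjC.
by apply: noC4; exists u, a, v, b; rewrite (adjC _ a) (adjC _ b).
Qed.

Lemma adj_add_edge (T : finType) (H : sgraph T) (u v x y : T) :
  adj (add_edge H [set u; v]) x y
    = (x != y) && (([set x; y] == [set u; v]) || adj H x y).
Proof. by rewrite adj_graph_of in_setU1. Qed.

(** If one edge of the 4-cycle is new, the other three are old, since a repeated edge would identify
    two of its vertices. The new edge is listed first; other positions follow by rotating the
    cycle. *)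
Lemma new_C4_walk (T : finType) (H : sgraph T) (u v x y z t : T) :
    let H' := add_edge H [set u; v] in
    x != z -> y != t -> adj H' x y -> adj H' y z -> adj H' z t -> adj H' t x ->
    [set x; y] = [set u; v] ->
  exists a b, [/\ adj H u a, adj H a b & adj H b v].
Proof.
move=> /= xz yt; rewrite !adj_add_edge.
move=> /andP[xy _] /andP[yz yzH] /andP[zt ztH] /andP[tx txH] E.
have {}yzH : adj H y z.
  case/orP: yzH => // /eqP; rewrite -E => /set2_eq[][Dy Dz].
    by rewrite Dy eqxx in xy.
  by rewrite Dz eqxx in xz.
have {}ztH : adj H z t.
  case/orP: ztH => // /eqP; rewrite -E => /set2_eq[][Dz Dt].
    by rewrite Dz eqxx in xz.
  by rewrite Dz eqxx in yz.
have {}txH : adj H t x.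
  case/orP: txH => // /eqP; rewrite -E => /set2_eq[][Dt Dx].
    by rewrite Dt eqxx in tx.
  by rewrite Dt eqxx in yt.
case/set2_eq: E => -[<- <-]; last by exists z, t.
by exists t, z; rewrite (adjC _ x t) (adjC _ t z) (adjC _ z y).
Qed.

Lemma saturatedE k n (H : sgraph ('I_k * 'I_n)%type) :
  saturated (complete_multipartite k n) (cycle_graph 4) H
    <-> partite_saturated fst H.
Proof.
set K := complete_multipartite k n; set F := cycle_graph 4.
split=> [/and3P[/subsetP sHK noC4 /forall_inP satH]|[proper noC4 walk]].
  have noC4' := (C4_freeE H).2 noC4.
  split=> // [u v uv|u v uv nuv].
    by rewrite -adj_complete_multipartite; apply: sHK.
  have /satH/contains_C4P : [set u; v] \in edges K :\: edges H.
    rewrite in_setD nuv; have := adj_complete_multipartite u v.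
    by rewrite /adj uv => ->.
  move=> [x [y [z [t [xz yt [xy yz zt tx]]]]]].
  have [E|nxy] := eqVneq [set x; y] [set u; v]; first exact: new_C4_walk xz yt xy yz zt tx E.
  have zx : z != x by rewrite eq_sym.
  have ty : t != y by rewrite eq_sym.
  have [E|nyz] := eqVneq [set y; z] [set u; v]; first exact: new_C4_walk yt zx yz zt tx xy E.
  have [E|nzt] := eqVneq [set z; t] [set u; v]; first exact: new_C4_walk zx ty zt tx xy yz E.
  have [E|ntx] := eqVneq [set t; x] [set u; v]; first exact: new_C4_walk ty xz tx xy yz zt E.
  move: xy yz zt tx; rewrite !adj_add_edge (negPf nxy) (negPf nyz) (negPf nzt) (negPf ntx) /=.
  move=> /andP[_ xy] /andP[_ yz] /andP[_ zt] /andP[_ tx].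
  by case: (noC4' x z y t); rewrite // adjC.
apply/and3P; split; last 1 first.
- apply/forall_inP => e; rewrite in_setD => /andP[eH eK].
  have := subsetP (edgesP K) _ eK; rewrite inE => /cards2P[u [v [uv De]]].
  have {eK} cuv : u.1 != v.1 by rewrite -adj_complete_multipartite /adj -De.
  have {eH} nuv : ~~ adj H u v by rewrite /adj -De.
  have [a [b [ua ab bv]]] := walk u v cuv nuv.
  apply/contains_C4P; exists u, a, b, v; rewrite De !adj_add_edge.
  rewrite ua ab bv !orbT !(adj_neq ua, adj_neq ab, adj_neq bv) [v == u]eq_sym uv.
  rewrite [[set v; u]]setUC eqxx; split=> //.
    by apply: contraNneq nuv => ->.
  by apply: contraNneq nuv => <-.
- apply/subsetP => e eH; have := subsetP (edgesP H) _ eH.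
  rewrite inE => /cards2P[u [v [uv De]]].
  have : adj K u v by rewrite adj_complete_multipartite proper // /adj -De.
  by rewrite /adj -De.
exact/C4_freeE.
Qed.

(** * Multipartitions and isomorphic copies *)

Definition graph_of_rel (T : finType) (r : rel T) : sgraph T :=
  graph_of [set [set p.1; p.2] | p : T * T & r p.1 p.2].

Lemma adj_graph_of_rel (T : finType) (r : rel T) : symmetric r ->
  forall u v, adj (graph_of_rel r) u v = (u != v) && r u v.
Proof.
move=> symr u v; rewrite adj_graph_of; congr (_ && _).
apply/imsetP/idP => [[[a b]]|uv]; last by exists (u, v); rewrite ?inE.
by rewrite inE /= => ab /set2_eq[][-> ->] //; rewrite symr.
Qed.

Lemma isomorphic_nedges (T U : finType) (G : sgraph T) (H : sgraph U) :
  isomorphic G H -> nedges G = nedges H.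
Proof.
move=> [f [[g fK gK] adjf]]; suff : 2 * nedges G = 2 * nedges H by lia.
rewrite -!sum_deg (reindex f) /=; last by exists g => v _.
apply: eq_bigr => v _; rewrite /deg -(card_imset _ (can_inj fK)).
apply: eq_card => w; apply/imsetP/idP => [[u]|].
  by rewrite !in_nbhd => vu ->; rewrite adjf.
by rewrite in_nbhd -(gK w) adjf => vw; exists (g w); rewrite ?in_nbhd.
Qed.

Lemma partite_saturated_iso (T U : finType) (C D : eqType) (c : T -> C)
    (d : U -> D) (G : sgraph T) (H : sgraph U) (f : T -> U) :
    bijective f -> (forall u v, adj H (f u) (f v) = adj G u v) ->
    (forall u v, (d (f u) == d (f v)) = (c u == c v)) ->
  partite_saturated c G -> partite_saturated d H.
Proof.
move=> [g fK gK] adjf df [proper noC4 walk].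
have adjg u v : adj H u v = adj G (g u) (g v) by rewrite -adjf !gK.
have dg u v : (d u == d v) = (c (g u) == c (g v)) by rewrite -df !gK.
split=> [u v|u v a b uv ab|u v].
- by rewrite adjg dg => /proper.
- by rewrite !adjg; apply: noC4; rewrite (can_eq gK).
rewrite adjg dg => /walk H1 /H1[a [b [ua ab bv]]].
by exists (f a), (f b); rewrite !adjg !fK.
Qed.

Lemma in_bigcup_nat (T : finType) (V : nat -> {set T}) m l v :
  reflect (exists2 i, m <= i < l & v \in V i) (v \in \bigcup_(m <= i < l) V i).
Proof.
have -> : (v \in \bigcup_(m <= i < l) V i) = has (fun i => v \in V i) (index_iota m l).
  by elim: (index_iota m l) => [|i s IHs]; rewrite (big_nil, big_cons) ?inE //= -IHs.
by apply: (iffP hasP) => -[i]; [rewrite mem_index_iota | rewrite -mem_index_iota];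
  exists i.
Qed.

Section Classes.
Variables (k n : nat) (T : finType) (c : T -> 'I_k).
Hypothesis card_class : forall i, #|[set v | c v == i]| = n.

Lemma card_classes : #|T| = k * n.
Proof.
rewrite -sum1_card (partition_big c predT) //= -[k in RHS]card_ord -sum_nat_const.
by apply: eq_bigr => i _; rewrite sum1dep_card.
Qed.

(** A vertex is sent to its colour and its rank inside its colour class, so equal class sizes
    identify [T] with the vertices of the complete multipartite graph. *)
Lemma class_bijection : exists2 f : T -> 'I_k * 'I_n, bijective f & forall v, (f v).1 = c v.
Proof.
pose D i := [set v | c v == i].
have r_lt v : index v (enum (D (c v))) < n.
  by rewrite -(card_class (c v)) cardE index_mem mem_enum inE.
exists (fun v => (c v, Ordinal (r_lt v))) => //.
apply: inj_card_bij => [u v [Dc]|]; last by rewrite card_prod !card_ord card_classes.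
rewrite Dc => /(congr1 (nth v (enum (D (c v))))).
by rewrite !nth_index // mem_enum inE ?Dc.
Qed.

End Classes.

Section Multipartition.
Variables (k n : nat) (T : finType) (G : sgraph T) (V : nat -> {set T}).
Hypothesis VG : multipartition k n G V.

(** Colours start at 0 while parts start at 1, hence the successor. *)
Lemma multipartition_colouring : exists c : T -> 'I_k,
  [/\ forall i, #|[set v | c v == i]| = n, forall u v, adj G u v -> c u != c v
    & forall i v, 0 < i <= k -> (v \in V i) = ((c v).+1 == i)].
Proof.
have [cover disj cardV indep] := VG.
have class v : exists i : 'I_k, v \in V i.+1.
  have : v \in \bigcup_(1 <= i < k.+1) V i by rewrite cover.
  case/in_bigcup_nat=> -[//|i] /andP[_ ik] vi.
  by exists (Ordinal (ik : i < k)).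
pose c v := xchoose (class v); have cV v : v \in V (c v).+1 := xchooseP (class v).
have cE i v : 0 < i <= k -> (v \in V i) = ((c v).+1 == i).
  move=> hi; apply/idP/eqP => [vi|<- //]; apply/eqP/contraT => ci.
  have := disj _ _ (_ : 0 < (c v).+1 <= k) hi ci; rewrite ltn_ord => /(_ isT).
  by move/disjoint_setI0/setP/(_ v); rewrite in_setI cV vi inE.
have cE' (i : 'I_k) v : (v \in V i.+1) = (c v == i) by rewrite cE // ltn_ord.
exists c; split=> // [i|u v].
  by rewrite -(cardV i.+1 (ltn_ord i)); apply: eq_card => v; rewrite inE cE'.
apply: contraTneq => cuv; have := indep (c u).+1 (ltn_ord _) u v (cV u).
by rewrite cuv => /(_ (cV v)).
Qed.

Lemma multipartition_complement : 3 <= k ->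
  \bigcup_(4 <= i < k.+1) V i = ~: (V 1 :|: V 2 :|: V 3).
Proof.
move=> k3; have [c [_ _ cV]] := multipartition_colouring.
apply/setP => v; rewrite in_setC !in_setU !cV //; try lia.
apply/in_bigcup_nat/idP => [[i hi]|nv].
  by rewrite cV; lia.
by exists (c v).+1; [have := ltn_ord (c v); lia | rewrite cV ?eqxx ?ltn_ord].
Qed.

End Multipartition.

(** By [Y_nedges] the size depends only on the number of pendant vertices, which is 3n in the odd
    case and 3n - 1 in the even one; this parity split accounts for the floor. The graph is then
    transported along [class_bijection]. *)
Lemma Y_family_saturated k n (T : finType) (G : sgraph T) :
    3 <= k -> 0 < n -> Y_family k n G ->
  exists2 H : sgraph ('I_k * 'I_n)%type,
    saturated (complete_multipartite k n) (cycle_graph 4) H /\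
    nedges H = (3 * (k - 1) * n - 2) %/ 2 &
    isomorphic G H.
Proof.
move=> k3 n0 [V VG YG]; have [c [card_c proper cV]] := multipartition_colouring VG.
have cardV i : 0 < i <= k -> #|V i| = n by case: VG => _ _ cardV _; apply: cardV.
have disjV i j : 0 < i <= k -> 0 < j <= k -> i != j -> [disjoint V i & V j].
  by case: VG => _ disj _ _; apply: disj.
have classV i u v : 0 < i <= k -> u \in V i -> v \in V i -> c u = c v.
  by move=> hi; rewrite !cV // => /eqP <- /eqP[]/val_inj.
have cardT := card_classes card_c.
have [satG nG] : partite_saturated c G /\ nedges G = (3 * (k - 1) * n - 2) %/ 2.
  have PE := multipartition_complement VG k3.
  have card3 (A B D : {set T}) : [disjoint A & B] -> [disjoint A :|: B & D] ->
      #|A :|: B :|: D| = #|A| + #|B| + #|D|.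
    by move=> /disjoint_setI0 AB /disjoint_setI0 ABD; rewrite !cardsU ABD AB !cards0 !subn0.
  have V12 : [disjoint V 1 & V 2] by apply: disjV; lia.
  have V123 : [disjoint V 1 :|: V 2 & V 3].
    by rewrite -setI_eq0 setIUl !disjoint_setI0 ?setU0 //; apply: disjV; lia.
  case: ifP YG => [odd_kn Y|even_kn [V3m [V3p [V3E V3d cV3m cV3p Y]]]].
    split; first by apply: (Y_saturated PE Y proper) => i u v hi; apply: classV; lia.
    have := Y_nedges PE Y; rewrite PE setCK card3 // !cardV ?cardT; lia.
  set W := fun i => _ in Y; set P := _ :|: _ in Y.
  have V3mE v : v \in V3m = (v \in V 3) && (v \notin V3p).
    rewrite -V3E in_setU; case: (boolP (v \in V3m)) => [vm|vm] /=.
      by have /setP/(_ v) := disjoint_setI0 V3d; rewrite in_setI vm inE /= => ->.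
    by case: (v \in V3p).
  have V3pE v : v \in V3p -> v \in V 3 by rewrite -V3E in_setU => ->; rewrite orbT.
  have PE' : P = ~: (W 1 :|: W 2 :|: W 3).
    apply/setP => v; rewrite /P PE in_setU !in_setC !in_setU /W /= V3mE.
    case: (boolP (v \in V3p)) => [vp|]; rewrite ?andbT //=; have v3 := V3pE v vp.
    rewrite v3 /= !orbF negb_or.
    by move: v3; rewrite !cV; lia.
  split.
    apply: (Y_saturated PE' Y proper) => i u v hi; rewrite /W.
    case: eqP => [_|_]; last by apply: classV; lia.
    by rewrite !V3mE => /andP[u3 _] /andP[v3 _]; apply: classV u3 v3; lia.
  have := Y_nedges PE' Y; rewrite PE' setCK card3 // /W /= ?cV3m ?cardV ?cardT //; try lia.
  rewrite -setI_eq0; apply/eqP/setP => v; rewrite in_setI V3mE in_set0.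
  have /setP/(_ v) := disjoint_setI0 V123; rewrite in_setI in_set0.
  by case: (v \in V 3); rewrite ?andbF // andbT => ->.
have [f bij_f fc] := class_bijection card_c; have [g fK gK] := bij_f.
pose r := [rel u v | adj G (g u) (g v)].
have symr : symmetric r by move=> u v; rewrite /= adjC.
have adjH u v : adj (graph_of_rel r) (f u) (f v) = adj G u v.
  rewrite adj_graph_of_rel //= !fK (can_eq fK).
  by apply: andb_idl => /adj_neq.
have isoG : isomorphic G (graph_of_rel r) by exists f.
exists (graph_of_rel r) => //; split; last by rewrite -(isomorphic_nedges isoG).
apply/saturatedE; apply: partite_saturated_iso bij_f adjH _ satG => u v.
by rewrite !fc.
Qed.

(** * Existence of a Y-graph *)

Section HubConstruction.
Variables (T : finType) (X P : {set T}) (h m : T -> T).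
Hypothesis XP : X \subset P.
Hypothesis hX : forall v, v \notin X -> h v \in X.
Hypothesis mP : forall v, v \in P :\: X ->
  [/\ m v \in P :\: X, m v != v, m (m v) = v & h (m v) = h v].

Definition hub_rel : rel T := fun u v =>
  [|| (u \in X) && (v \in X), (u \notin X) && (v == h u),
      (v \notin X) && (u == h v) | (u \in P :\: X) && (v == m u)].

Definition hub_graph : sgraph T := graph_of_rel hub_rel.

Lemma hub_rel_sym : symmetric hub_rel.
Proof.
suff sub u v : hub_rel u v -> hub_rel v u by move=> u v; apply/idP/idP => /sub.
case/or4P=> /andP[uX]; rewrite /hub_rel.
- by move->; rewrite uX.
- by move->; rewrite uX ?orbT.
- by move->; rewrite uX ?orbT.
by move=> /eqP->; have [-> _ -> _] := mP uX; rewrite eqxx !orbT.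
Qed.

Lemma adj_hub_graph u v : adj hub_graph u v = (u != v) && hub_rel u v.
Proof. exact: adj_graph_of_rel hub_rel_sym u v. Qed.

Lemma hub_neq u v : u \notin X -> v \notin X -> (u == h v) = false.
Proof. by move=> uX vX; apply: contraNF uX => /eqP->; apply: hX. Qed.

Lemma hub_nbhd_leaf v : v \notin P -> nbhd hub_graph v = [set h v].
Proof.
move=> vP; have vX : v \notin X by apply: contraNN vP; apply: (subsetP XP).
apply/setP => w; rewrite in_nbhd adj_hub_graph /hub_rel in_setD (negPf vP) andbF orbF.
rewrite (negPf vX) /= in_set1; apply/andP/eqP => [[_ /orP[/eqP//|/andP[wX]]]|->].
  by rewrite hub_neq.
by rewrite eqxx; split=> //; apply: contraTneq (hX vX) => <-.
Qed.

Lemma hub_nbhd_matched v : v \in P :\: X -> nbhd hub_graph v = [set h v; m v].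
Proof.
move=> vV; have vX : v \notin X by move: vV; rewrite in_setD => /andP[].
apply/setP => w; rewrite in_nbhd adj_hub_graph /hub_rel vV (negPf vX) /= in_set2.
have -> : (w \notin X) && (v == h w) = false.
  by apply/andP => -[wX]; rewrite hub_neq.
apply: andb_idl => /orP[]/eqP->; first by apply: contraTneq (hX vX) => <-.
by rewrite eq_sym; have [] := mP vV.
Qed.

Lemma hub_graph_proper (C : eqType) (c : T -> C) :
    (forall u v, u \in X -> v \in X -> u != v -> c u != c v) ->
    (forall v, v \notin X -> c (h v) != c v) ->
    (forall v, v \in P :\: X -> c (m v) != c v) ->
  forall u v, adj hub_graph u v -> c u != c v.
Proof.
move=> cX ch cm u v; rewrite adj_hub_graph => /andP[uv /or4P[]/andP[uX]].
- by move=> vX; apply: cX.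
- by move/eqP->; rewrite eq_sym; apply: ch.
- by move/eqP->; apply: ch.
by move/eqP->; rewrite eq_sym; apply: cm.
Qed.

Lemma hub_Y_structure (W : nat -> {set T}) (y : nat -> T) :
    X = [set y 1; y 2; y 3] -> #|X| = 3 ->
    (forall i v, 1 <= i <= 3 -> v \in W i -> v \notin P /\ h v = y i) ->
  Y_structure hub_graph W P.
Proof.
move=> XE cX WP; exists y; rewrite /= -XE.
have VX v : v \in P :\: X -> v \notin X by rewrite in_setD => /andP[].
have hV v : v \notin X -> h v \notin P :\: X by move/hX; rewrite in_setD => ->.
have NV u : u \in P :\: X -> #|nbhd hub_graph u :&: (P :\: X)| = 1.
  move=> uV; have [mV _ _ _] := mP uV; apply/eqP/cards1P; exists (m u).
  apply/setP => w; rewrite hub_nbhd_matched // in_setI in_set2 in_set1.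
  have [->|_] /= := eqVneq w (h u); last by apply: andb_idr => /eqP->.
  rewrite (negPf (hV _ (VX _ uV))); apply/esym/eqP => Dm.
  by have := hV _ (VX _ uV); rewrite Dm mV.
split=> //.
- split=> //; split=> // u v uX vX uv.
  by rewrite adj_hub_graph uv /hub_rel uX vX.
- by move=> i v hi vW; have [vP <-] := WP i v hi vW; apply: hub_nbhd_leaf.
- move=> u uV; have [mV _ _ _] := mP uV.
  have hm : h u != m u by apply: contraNneq (hV _ (VX _ uV)) => ->.
  split; [by rewrite /deg hub_nbhd_matched // cards2 hm | | exact: NV].
  apply/eqP/cards1P; exists (h u); apply/setP => w.
  rewrite hub_nbhd_matched // in_setI in_set2 in_set1.
  have [->|_] /= := eqVneq w (h u); first by rewrite hX // VX.
  by apply/andP => -[/eqP-> mX]; have := VX _ mV; rewrite mX.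
move=> u v uV vV; rewrite -in_nbhd hub_nbhd_matched // in_set2.
have [mV mu mm hm] := mP uV.
case/orP=> /eqP Dv; first by have := hV _ (VX _ uV); rewrite -Dv vV.
rewrite Dv !hub_nbhd_matched // mm hm.
split; first by apply/set0Pn; exists (h u); rewrite in_setI !set21.
apply/subsetP => w; rewrite in_setI !in_set2.
case: eqVneq => [->|_ /= /andP[/eqP->]]; first by rewrite hX // VX.
by rewrite (negPf mu).
Qed.

End HubConstruction.

Lemma colouring_multipartition k n (T : finType) (G : sgraph T) (q : T -> nat) :
    (forall v, q v < k) -> (forall i, i < k -> #|[set v | q v == i]| = n) ->
    (forall u v, adj G u v -> q u != q v) ->
  multipartition k n G (fun i => [set v | (q v).+1 == i]).
Proof.
move=> qk cardq proper; split=> [|i j _ _ ij|[|i] //= ik|i _ u v].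
- apply/setP => v; rewrite in_setT; apply/in_bigcup_nat.
  by exists (q v).+1; [have := qk v; lia | rewrite inE].
- rewrite -setI_eq0; apply/eqP/setP => v; rewrite !inE.
  by case: eqP => // ->; apply: negPf.
- by rewrite -(cardq i) //; apply: eq_card => v; rewrite !inE eqSS.
rewrite !inE => /eqP <-; rewrite eqSS => /eqP Dv.
by apply/negP => /proper; rewrite Dv eqxx.
Qed.

Lemma card_part k n (i : 'I_k) : #|[set v : 'I_k * 'I_n | v.1 == i]| = n.
Proof.
rewrite -[RHS]card_ord -(card_imset predT (f := pair i)) => [|a b [] //].
apply: eq_card => -[a b]; rewrite inE /=; apply/eqP/imsetP => [->|[j _ [-> //]]].
by exists b.
Qed.

Section Construction.
Variables (k n : nat).
Hypothesis (k5 : 5 <= k) (n2 : 2 <= n).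

Let T := ('I_k * 'I_n)%type.
Let e : nat := ~~ odd ((k - 1) * n).
Let d := k - 3.
Let M := d * n + e.

Let e_le1 : e <= 1. Proof. by rewrite /e; case: odd. Qed.
(** If [e] is 0 then [k - 1] is odd, so [k] is at least 6. Thus the first column has room for the
    whole triangle, apart from the extra vertex of the third part. *)
Let d_ge : 3 - e <= d.
Proof.
rewrite /e /d; case: (boolP (odd ((k - 1) * n))) => /=; last by lia.
rewrite oddM => /andP[]; lia.
Qed.
(** Removing the triangle must leave an even number of vertices to match. *)
Let M_odd : odd M.
Proof.
rewrite /M /e /d oddD oddM oddM; have -> : odd (k - 1) = odd (k - 3) by lia.
by case: (odd _ && _).
Qed.

(* The non-pendant vertices, enumerated column by column; when (k - 1) * n is
   even, the vertex (2, 0) of the third part comes first. *)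
Let pos (v : T) : nat := if 3 <= v.1 then v.2 * d + (v.1 - 3) + e else 0.
Let P := [set v : T | (3 <= v.1) || [&& e == 1, v.1 == 2 :> nat & v.2 == 0 :> nat]].

Let pos_ltM v : pos v < M.
Proof.
rewrite /pos /M; case: ifP => _; last by have := e_le1; nia.
have := ltn_ord v.1; have := ltn_ord v.2; rewrite /d; nia.
Qed.

Let pos_inj : {in P &, injective pos}.
Proof.
move=> [a b] [a' b']; rewrite !inE /pos /=.
have := ltn_ord a; have := ltn_ord a'; rewrite /d => a'k ak.
case: ifP => [a3 _|_ /= /and3P[/eqP e1 /eqP a2 /eqP b0]];
  case: ifP => [a'3 _|_ /= /and3P[/eqP e1' /eqP a'2 /eqP b'0]] Epos.
- have Eb : b = b' :> nat.
    have : b * (k - 3) + (a - 3) = b' * (k - 3) + (a' - 3) by lia.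
    by move/(congr1 (divn^~ (k - 3))); rewrite !divnMDl ?divn_small ?addn0; lia.
  by congr pair; apply: val_inj => //=; move: Epos; rewrite Eb; lia.
- by move: Epos; rewrite e1' addn1.
- by move: Epos; rewrite e1 addn1.
by congr pair; apply: val_inj => /=; lia.
Qed.

Let pos_surj r : r < M -> exists2 v, v \in P & pos v = r.
Proof.
move=> rM; have [re|er] := ltnP r e.
  have k2 : 2 < k by lia. have n0 : 0 < n by lia.
  exists (Ordinal k2, Ordinal n0); rewrite ?inE /pos /= ?andbT; have := e_le1; lia.
have d0 : 0 < d by rewrite /d; lia.
have ak : (r - e) %% d + 3 < k by have := ltn_pmod (r - e) d0; rewrite {2}/d; lia.
have bn : (r - e) %/ d < n by rewrite ltn_divLR //; move: rM; rewrite /M; lia.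
exists (Ordinal ak, Ordinal bn); rewrite ?inE /pos /= leq_addl //.
by rewrite addnK -divn_eq subnK.
Qed.

Let v0 : T := (Ordinal (leq_trans (isT : 0 < 5) k5), Ordinal (ltnW n2)).
Let vertex r : T := odflt v0 [pick v in P | pos v == r].

Let vertexP r : r < M -> vertex r \in P /\ pos (vertex r) = r.
Proof.
move=> rM; rewrite /vertex; case: pickP => [v /andP[vP /eqP] //|no].
by have [v vP Dr] := pos_surj rM; have := no v; rewrite vP Dr eqxx.
Qed.

Let posK v : v \in P -> vertex (pos v) = v.
Proof. by move=> vP; have [] := vertexP (pos_ltM v); move=> *; apply: pos_inj. Qed.

Let M_gt3 : 3 < M.
Proof. by rewrite /M; have := d_ge; have := e_le1; nia. Qed.

Let X := [set vertex 0; vertex 1; vertex 2].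

Let inX v : (v \in X) = (v \in P) && (pos v < 3).
Proof.
rewrite !in_setU !in_set1 -orbA; apply/or3P/andP => [[]/eqP->|[vP]].
- by have [|-> ->] := @vertexP 0; [have := M_gt3; lia|].
- by have [|-> ->] := @vertexP 1; [have := M_gt3; lia|].
- by have [|-> ->] := @vertexP 2; [have := M_gt3; lia|].
move: (posK vP); case: (pos v) => [|[|[|//]]] <- _; rewrite eqxx;
  by [constructor 1 | constructor 2 | constructor 3].
Qed.

(** By [d_ge], the first three positions lie in the first column, so the triangle occupies three
    consecutive parts. *)
Let part_lt3 v : v \in P -> pos v < 3 -> v.1 + e = 3 + pos v :> nat.
Proof.
rewrite inE /pos; case: ifP => [v3 _ | _ /= /and3P[/eqP -> /eqP -> //]].
have := e_le1; have := d_ge; move: v3.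
move: (nat_of_ord v.1) (nat_of_ord v.2) => a b.
case: (posnP b) => [->|/(leq_pmull d)]; lia.
Qed.

(** Positions from 3 on are paired as (3,4), (5,6) and so on; the last position M - 1 is even
    because [M] is odd. *)
Let mate r := if odd r then r.+1 else r.-1.
Let m v := vertex (mate (pos v)).

Let mateP v : v \in P :\: X ->
  [/\ m v \in P :\: X, (m v).1 != v.1, m (m v) = v & m v != v].
Proof.
rewrite in_setD inX => /andP[+ vP]; rewrite vP -leqNgt => v3.
have vM := pos_ltM v.
have mM : mate (pos v) < M.
  by move: M_odd vM; rewrite /mate; case: ifP; lia.
have [mP mE] := vertexP mM; rewrite -/(m v) in mP mE.
have mm : mate (mate (pos v)) = pos v by rewrite /mate; do 2!case: ifP; lia.
(* Positions past the triangle in the same part differ by a multiple of [d], which is at least 2,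
   whereas mates are consecutive. *)
have part : (m v).1 != v.1.
  have d2 : 1 < d by rewrite /d; lia.
  apply/eqP => Dpart; have : pos (m v) = (pos v).+1 \/ (pos (m v)).+1 = pos v.
    by rewrite mE /mate; case: ifP; lia.
  have mv3 : 3 <= pos (m v) by rewrite mE /mate; case: ifP; lia.
  move: v3 mv3; rewrite /pos Dpart; case: ifP => // _ _ _.
  move: (nat_of_ord (m v).2) (nat_of_ord v.2) (nat_of_ord v.1) => b b' a.
  by case: (ltngtP b b') => [lt_bb' | lt_bb' | -> ]; last lia;
    have := leq_mul lt_bb' (leqnn d); rewrite mulSn; lia.
split=> //; last by apply: contraNneq part => ->.
  by rewrite in_setD mP inX mP mE /mate andbT; case: ifP; lia.
by rewrite /m -/(m v) mE mm posK.
Qed.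

(** The condition is symmetric in [v] and [m v], so both ends of a matching edge pick the same
    hub. *)
Let free (v z : T) : bool := (z.1 != v.1) && (z.1 != (m v).1).
Let h (v : T) : T := if v \in P then odflt v0 [pick z in X | free v z] else vertex v.1.

Let notP v : v \notin P -> v.1 < 3.
Proof. by rewrite inE negb_or -leqNgt ltnS => /andP[]. Qed.

Let lt3M r : r < 3 -> r < M.
Proof. by move=> r3; apply: ltn_trans M_gt3. Qed.

Let vertex_part r : r < 3 -> (vertex r).1 + e = 3 + r :> nat.
Proof.
move=> r3; have [rP Dr] := vertexP (lt3M r3).
by have := part_lt3 rP; rewrite Dr; apply.
Qed.

Let vertexX r : r < 3 -> vertex r \in X.
Proof. by move=> r3; have [rP Dr] := vertexP (lt3M r3); rewrite inX rP Dr. Qed.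

(** The triangle meets three parts, and a matching edge blocks at most two of them. *)
Let h_pick v : v \in P -> (h v \in X) && free v (h v).
Proof.
move=> vP; rewrite /h vP; case: pickP => [z //|no].
have taken r : r < 3 -> (vertex r).1 = v.1 :> nat \/ (vertex r).1 = (m v).1 :> nat.
  move=> r3; have := no (vertex r); rewrite vertexX //= => /negbT.
  by rewrite negb_and !negbK => /orP[]/eqP->; [left | right].
have := vertex_part (isT : 0 < 3); have := vertex_part (isT : 1 < 3).
have := vertex_part (isT : 2 < 3); have := taken 0 isT; have := taken 1 isT.
by have := taken 2 isT; lia.
Qed.

Let hX v : v \notin X -> h v \in X.
Proof.
move=> vX; have [/h_pick/andP[] //|vP] := boolP (v \in P).
by rewrite /h (negPf vP) vertexX // notP.
Qed.

Let h_part v : v \notin X -> (h v).1 != v.1.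
Proof.
move=> vX; have [/h_pick/and3P[] //|vP] := boolP (v \in P).
rewrite /h (negPf vP); have := vertex_part (notP vP); have := e_le1.
by move=> e1 Dv; apply/eqP => Dp; move: Dv; rewrite Dp; lia.
Qed.

Let mP v : v \in P :\: X -> [/\ m v \in P :\: X, m v != v, m (m v) = v & h (m v) = h v].
Proof.
move=> vV; have [mV _ mm mv] := mateP vV; split=> //.
move: mV vV; rewrite !in_setD => /andP[_ mP'] /andP[_ vP].
rewrite /h mP' vP; congr odflt; apply: eq_pick => z.
by rewrite /free mm [X in _ && X]andbC.
Qed.

Let XP : X \subset P.
Proof. by apply/subsetP => v; rewrite inX => /andP[]. Qed.

Let inP v : (v \in P) = (3 <= v.1) || ((e == 1) && (v == vertex 0)).
Proof.
have [v0P v0pos] := vertexP (lt3M (isT : 0 < 3)).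
apply/idP/orP => [|[v3|/andP[_ /eqP-> //]]]; last by rewrite inE v3.
move=> vP; move: (vP); rewrite inE => /orP[|/and3P[e1 v2 _]]; [by left | right].
have Dpos : pos v = 0 by rewrite /pos (eqP v2).
by rewrite e1 -Dpos posK ?eqxx.
Qed.

Lemma Y_family_nonempty : exists G : sgraph ('I_k * 'I_n)%type, Y_family k n G.
Proof.
pose V i := [set v : T | (v.1).+1 == i]; pose G := hub_graph X P h m.
have cX : #|X| = 3.
  rewrite /X -setUA cardsU1 cards2 in_set2.
  have neq r s : r < s < 3 -> vertex r != vertex s.
    move=> /andP[rs s3]; have rl := ltn_trans rs s3.
    apply: contraTneq rs => Drs; rewrite -leqNgt.
    by have := vertex_part s3; rewrite -Drs (vertex_part rl); lia.
  by rewrite (negPf (neq 0 1 isT)) (negPf (neq 0 2 isT)) (neq 1 2 isT).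
have proper u v : adj G u v -> u.1 != v.1.
  apply: (hub_graph_proper mP (c := fst)) => [a b aX bX ab|a|a]; last 2 first.
  - exact: h_part.
  - by case/mateP.
  move: aX bX; rewrite !inX => /andP[aP a3] /andP[bP b3].
  apply: contraNneq ab => Dab; apply/eqP/pos_inj => //.
  by have := part_lt3 aP a3; rewrite Dab (part_lt3 bP b3); lia.
have VG : multipartition k n G V.
  apply: colouring_multipartition => // i ik.
  by rewrite -[RHS](card_part n (Ordinal ik)); apply: eq_card => v; rewrite !inE.
have YS (W : nat -> {set T}) :
    (forall i v, 1 <= i <= 3 -> v \in W i -> v \notin P /\ v.1.+1 = i) ->
  Y_structure G W P.
  move=> WP; apply: (hub_Y_structure XP hX mP (y := fun i => vertex i.-1)) => // i v hi vW.
  have [vP Di] := WP i v hi vW; split=> //.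
  by rewrite /h (negPf vP) -Di.
have compl := multipartition_complement VG (leq_trans (isT : 3 <= 5) k5).
exists G; exists V => //; rewrite compl; case: ifP => [odd_kn|even_kn].
  have e0 : e = 0 by rewrite /e odd_kn.
  have <- : P = ~: (V 1 :|: V 2 :|: V 3).
    by apply/setP => v; rewrite inP e0 /= orbF !inE; case: (nat_of_ord v.1) => [|[|[|]]].
  apply: YS => i v hi; rewrite inE => /eqP Di; split=> //.
  by rewrite inP e0 /= orbF -leqNgt; lia.
have e1 : e = 1 by rewrite /e even_kn.
have p0 : (vertex 0).1 = 2 :> nat by have := vertex_part (isT : 0 < 3); rewrite e1; lia.
have v0V : vertex 0 \in V 3 by rewrite inE p0.
exists (V 3 :\ vertex 0), [set vertex 0]; split.
- by rewrite setUC setD1K.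
- by rewrite disjoint_sym disjoints1 in_setD1 eqxx.
- have cV3 : #|V 3| = n by case: VG => _ _ cardV _; apply: cardV; lia.
  have /(congr1 predn) := cardsD1 (vertex 0) (V 3).
  by rewrite v0V cV3 add1n /= subn1 => ->.
- exact: cards1.
have <- : P = [set vertex 0] :|: ~: (V 1 :|: V 2 :|: V 3).
  apply/setP => v; rewrite inP e1 /= in_setU in_set1 orbC; congr (_ || _).
  by rewrite !inE; case: (nat_of_ord v.1) => [|[|[|]]].
apply: YS => i v hi; rewrite inP e1 /=; case: (eqVneq i 3) => [-> | i3].
  by rewrite in_setD1 inE => /andP[/negPf-> /eqP[->]].
rewrite inE => /eqP Di; split=> //; rewrite negb_or -leqNgt; apply/andP; split; first by lia.
by apply/eqP => Dv; move: Di; rewrite Dv p0; lia.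
Qed.

End Construction.

(** * Extremal graphs *)

Section Extremal.
Variables (k n : nat) (H : sgraph ('I_k * 'I_n)%type).
Hypothesis (k5 : 5 <= k) (n2 : 2 <= n).
Hypothesis satH : partite_saturated fst H.

Let T := ('I_k * 'I_n)%type.

Let card_class (v : T) : #|[set w : T | w.1 == v.1]| = n.
Proof. exact: card_part. Qed.

Let two_classes (v : T) : exists w : T, w.1 != v.1.
Proof.
have n0 : 0 < n by lia.
have k0 : 0 < k by lia.
have k1 : 1 < k by lia.
have [v0|v0] := eqVneq (nat_of_ord v.1) 0.
  exists (Ordinal k1, Ordinal n0); apply: contraTneq isT => /= /(congr1 val) /=.
  by rewrite v0.
exists (Ordinal k0, Ordinal n0); apply: contraNneq v0 => /= /(congr1 val) /= <-.
by [].
Qed.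

Let cardT : #|{: T}| = k * n.
Proof. by rewrite card_prod !card_ord. Qed.

(** The three leaf classes lie in different parts and miss at most one vertex in total. With the
    smallest class last, the first two fill their parts, and the last has n or n - 1 vertices. *)
Lemma ordered_leaves_Y_family (x : 'I_3 -> T) :
    (forall i, x i \in leaves H) -> (forall i j, i != j -> (x i).1 != (x j).1) ->
    (forall i, #|[set v | nbhd H v == nbhd H (x ord_max)]|
       <= #|[set v | nbhd H v == nbhd H (x i)]|) ->
    2 * nedges H + 3 * n + 2 <= 3 * (k * n) ->
  Y_family k n H.
Proof.
move=> xL cx minL small; pose p i := (x i).1.
have nbr v : exists w, adj H v w := psat_nbhd_neq0 satH two_classes v.
pose y i := xchoose (nbr (x i)); have xy i : adj H (x i) (y i) := xchooseP (nbr (x i)).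
have [|hubs mates cL] := triangle_extremal satH card_class xL xy cx.
  by rewrite cardT.
pose L i := [set v | nbhd H v == nbhd H (x i)].
have Nx i : nbhd H (x i) = [set y i].
  apply/setP => w; rewrite in_nbhd in_set1; apply/idP/eqP => [xw|->//].
  by rewrite (leaf_nbr (xL i) xw (xy i)).
have LP i v : reflect (v \in leaves H /\ adj H v (y i)) (v \in L i).
  rewrite [v \in L i]inE Nx; apply: (iffP eqP) => [Nv|[vL vy]].
    by rewrite inE /deg -in_nbhd Nv cards1 set11.
  apply/setP => w; rewrite in_nbhd in_set1; apply/idP/eqP => [vw|->//].
  exact: leaf_nbr vL vw vy.
have L_class i v : v \in L i -> v.1 = p i.
  case/LP=> vL vy; apply/eqP/contraT => cv.
  by have := leaf_supports_adj satH vL (xL i) vy (xy i) cv; rewrite adjxx.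
have leavesE : leaves H = L ord0 :|: L (inord 1) :|: L ord_max.
  apply/setP => v; rewrite !in_setU; apply/idP/idP => [vL|]; last first.
    by rewrite -orbA => /or3P[]/LP[].
  have [i vi] := hubs v (leaf_notin_support satH xL xy cx vL).
  have : v \in L i by apply/LP.
  case: i {vi} => [[|[|[|//]]] hi]; rewrite -orbA => vLi; apply/or3P.
  - by constructor 1; rewrite (_ : ord0 = Ordinal hi) //; apply: val_inj.
  - by constructor 2; rewrite (_ : inord 1 = Ordinal hi) //; apply: val_inj; rewrite /= inordK.
  - by constructor 3; rewrite (_ : ord_max = Ordinal hi) //; apply: val_inj.
have sub_class i : L i \subset [set v | v.1 == p i].
  by apply/subsetP => v /L_class vi; rewrite inE vi.
have L_le i : #|L i| <= n.
  by rewrite -[X in _ <= X](card_part n (p i)); apply: subset_leq_card.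
have L_full i : #|L i| = n -> L i = [set v | v.1 == p i].
  by move=> cLi; apply/eqP; rewrite eqEcard sub_class cLi card_part /=.
have cleaves : #|leaves H| = #|L ord0| + #|L (inord 1)| + #|L ord_max|.
  have disj i j : i != j -> L i :&: L j = set0.
    move=> ij; apply/setP => v; rewrite in_setI in_set0.
    apply/andP => -[/L_class vi /L_class vj].
    by have := cx i j ij; rewrite -/(p i) -/(p j) -vi -vj eqxx.
  rewrite leavesE !cardsU setIUl !disj ?setU0 ?cards0 ?subn0 //.
  - by apply/eqP => /(congr1 val); rewrite /= inordK.
  - by apply/eqP => /(congr1 val); rewrite /= inordK.
have minL' i : #|L ord_max| <= #|L i| := minL i.
rewrite cleaves in cL.
have cL0 : #|L ord0| = n.
  have := minL' ord0; have := minL' (inord 1); have := L_le ord0; have := L_le (inord 1); lia.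
have cL1 : #|L (inord 1)| = n.
  have := minL' ord0; have := minL' (inord 1); have := L_le ord0; have := L_le (inord 1); lia.
have cL2 : n <= #|L ord_max| + 1 <= n.+1.
  have := L_le ord_max; lia.
(* The parts are renumbered so that those of the three leaf classes come first. *)
pose s := [:: p ord0; p (inord 1); p ord_max].
have us : uniq s.
  rewrite /= !inE negb_or !cx //; by apply/eqP => /(congr1 val); rewrite /= inordK.
pose cols := s ++ [seq i <- enum 'I_k | i \notin s].
have ucols : uniq cols.
  rewrite cat_uniq us filter_uniq ?enum_uniq // andbT; apply/hasPn => i.
  by rewrite mem_filter => /andP[].
have in_cols i : i \in cols.
  by rewrite mem_cat mem_filter mem_enum andbT; case: (i \in s).
have size_cols : size cols = k.
  rewrite -[RHS](card_ord k) cardE; apply/perm_size/uniq_perm => // [|i].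
    exact: enum_uniq.
  by rewrite in_cols mem_enum.
pose q (v : T) := index v.1 cols.
pose V i := [set v | (q v).+1 == i].
have qE i (v : T) : i < k -> (q v == i) = (v.1 == nth (p ord0) cols i).
  move=> ik; apply/eqP/eqP => [<-|Dv]; first by rewrite nth_index.
  by rewrite /q Dv index_uniq // size_cols.
have VG : multipartition k n H V.
  apply: colouring_multipartition => [v|i ik|u v uv].
  - by rewrite -size_cols index_mem.
  - rewrite -[RHS](card_part n (nth (p ord0) cols i)).
    by apply: eq_card => v; rewrite !inE qE.
  apply: contraNneq (psat_proper satH uv) => Dq.
  by rewrite -[u.1](nth_index u.1 (in_cols u.1)) -/(q u) Dq nth_index.
have V1 : V 1 = L ord0.
  by rewrite L_full //; apply/setP => v; rewrite !inE eqSS qE //; lia.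
have V2 : V 2 = L (inord 1).
  by rewrite L_full //; apply/setP => v; rewrite !inE eqSS qE //; lia.
have V3 : V 3 = [set v | v.1 == p ord_max].
  by apply/setP => v; rewrite !inE eqSS qE //; lia.
pose W i := if i == 1 then L ord0 else if i == 2 then L (inord 1) else L ord_max.
have YS W' : (forall i, 1 <= i <= 3 -> W' i = W i) -> Y_structure H W' (~: leaves H).
  move=> WE; apply: (triangle_Y_structure satH two_classes xL xy cx) => // i hi v.
  rewrite WE // /W => vL; apply/LP; move: vL.
  case: i hi => [|[|[|//]]] hi /=.
  - by rewrite (_ : Ordinal hi = ord0) //; apply: val_inj.
  - by rewrite (_ : Ordinal hi = inord 1) //; apply: val_inj; rewrite /= inordK.
  - by rewrite (_ : Ordinal hi = ord_max) //; apply: val_inj.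
(* This equation fixes the parity of the number of leaves, and so decides between n and n - 1 for
   the last class. *)
have nH : 2 * nedges H + 3 + #|leaves H| = 3 * (k * n).
  have := Y_nedges (W := W) _ (YS W (fun _ _ => erefl)).
  by rewrite setCK cardT leavesE; apply.
have compl := multipartition_complement VG (leq_trans (isT : 3 <= 5) k5).
exists V => //; rewrite compl; case: ifP => [odd_kn|even_kn].
  have cL3 : #|L ord_max| = n.
    by move: nH odd_kn; rewrite cleaves cL0 cL1; nia.
  have V3' : V 3 = L ord_max by rewrite L_full.
  rewrite V1 V2 V3' -leavesE; apply: YS => i.
  by case: i => [|[|[|[|//]]]] // _; rewrite /W /= ?V1 ?V2 ?V3'.
have cL3 : #|L ord_max| = n - 1.
  by move: nH even_kn; rewrite cleaves cL0 cL1; nia.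
have L3V : L ord_max \subset V 3 by rewrite V3.
have cV3 : #|V 3| = n by rewrite V3 card_part.
exists (L ord_max), (V 3 :\: L ord_max); split=> //.
- apply/setP => v; rewrite in_setU in_setD.
  by have := subsetP L3V v; case: (v \in L ord_max) => //= ->.
- rewrite -setI_eq0; apply/eqP/setP => v; rewrite in_setI in_setD in_set0.
  by case: (v \in L ord_max).
- by rewrite cardsD (setIidPr L3V) cV3 cL3; lia.
have -> : V 3 :\: L ord_max :|: ~: (V 1 :|: V 2 :|: V 3) = ~: leaves H.
  apply/setP => v; rewrite in_setU in_setD !in_setC leavesE -V1 -V2 !in_setU.
  have := subsetP L3V v; case: (v \in L ord_max); rewrite /V !inE.
    by move=> -> //; rewrite !orbT.
  by move=> _; case: (q v) => [|[|[|]]].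
apply: YS => i; case: i => [|[|[|[|//]]]] // _; by rewrite /W /= ?V1 ?V2.
Qed.

Let rainbow (x : {ffun 'I_3 -> T}) :=
  [forall i, x i \in leaves H] && [forall i, forall j, (i != j) ==> ((x i).1 != (x j).1)].

Let rainbowP x : rainbow x ->
  (forall i, x i \in leaves H) /\ (forall i j, i != j -> (x i).1 != (x j).1).
Proof.
case/andP=> /forallP xL /forallP cx; split=> // i j.
by have /forallP/(_ j)/implyP := cx i.
Qed.

Let no_rainbow : rainbow =1 xpred0 -> 3 * (k * n) <= 2 * nedges H + 2 * n + 3.
Proof.
move=> no; rewrite -cardT.
apply: (few_leaf_colours_bound satH card_class two_classes n2) => x1 x2 x3 L1 L2 L3 c12 c13 c23.
pose x := [ffun i : 'I_3 => nth x1 [:: x1; x2; x3] i].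
have /negP[] := negbT (no x); apply/andP; split; apply/forallP => i.
  by rewrite ffunE; case: i => [[|[|[|]]]].
apply/forallP => j; rewrite !ffunE; apply/implyP; rewrite -val_eqE.
by case: i j => [[|[|[|//]]] ?] [[|[|[|//]]] ?] //= _; rewrite // eq_sym.
Qed.

Lemma saturated_nedges_bound : 3 * (k * n) <= 2 * nedges H + 3 * n + 3.
Proof.
case: (pickP rainbow) => [x /rainbowP[xL cx]|/no_rainbow]; last by lia.
have nbr v : exists w, adj H v w := psat_nbhd_neq0 satH two_classes v.
rewrite -cardT.
exact: (triangle_bound satH card_class xL (fun i => xchooseP (nbr (x i))) cx).
Qed.

Lemma extremal_Y_family : 2 * nedges H + 3 * n + 2 <= 3 * (k * n) -> Y_family k n H.
Proof.
(* Without three leaves in different parts, 2n + 3 replaces 3n + 3, which contradicts the hypothesis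
   because [n] is at least 2. *)
case: (pickP rainbow) => [x /rainbowP[xL cx]|/no_rainbow]; last by lia.
pose N v := #|[set w | nbhd H w == nbhd H v]|.
have [i0 _ minN] := @arg_minnP _ ord0 xpredT (fun i => N (x i)) isT.
(* The transposition moves the smallest leaf class to the last index. *)
pose t := tperm i0 ord_max.
apply: (@ordered_leaves_Y_family (fun i => x (t i))) => [i|i j ij|i].
- exact: xL.
- by apply: cx; rewrite (inj_eq perm_inj).
by rewrite tpermR; apply: minN.
Qed.

End Extremal.

Theorem theorem2p1 (k n : nat) (hk : 5 <= k) (hn : 2 <= n) :
  [/\ sat_num (complete_multipartite k n) (cycle_graph 4)
        = (3 * (k - 1) * n - 2) %/ 2,
      forall H : sgraph ('I_k * 'I_n)%type,
        H \in Sat (complete_multipartite k n) (cycle_graph 4) ->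
        exists (T : finType) (G : sgraph T), Y_family k n G /\ isomorphic H G
    & forall (T : finType) (G : sgraph T), Y_family k n G ->
        exists2 H : sgraph ('I_k * 'I_n)%type,
          H \in Sat (complete_multipartite k n) (cycle_graph 4)
          & isomorphic G H].
Proof.
set K := complete_multipartite k n; set F := cycle_graph 4.
have k3 : 3 <= k by lia.
have n0 : 0 < n by lia.
have sn : sat_num K F = (3 * (k - 1) * n - 2) %/ 2.
  have [G /(Y_family_saturated k3 n0)[H [satH nH] _]] := Y_family_nonempty hk hn.
  apply/eqP; rewrite eqn_leq -{1}nH sat_num_le //=.
  have [H0] := sat_num_attained satH; rewrite inE => /andP[/saturatedE satH0 /eqP <-].
  (* The bound says that 2e is at least 3(k-1)n - 3; half of this, rounded up, is the stated
     floor. *)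
  by have := saturated_nedges_bound hk hn satH0; nia.
split=> // [H|T G YG].
  rewrite inE sn => /andP[/saturatedE satH /eqP nH]; exists _, H; split.
    by apply: extremal_Y_family => //; rewrite nH; nia.
  by exists id; split=> //; exists id.
have [H [satH nH] isoGH] := Y_family_saturated k3 n0 YG.
by exists H => //; rewrite inE satH nH sn eqxx.
Qed.
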